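(* Let $\alpha>-1$, let $f$ be an $\alpha$-harmonic function in $\mathbb{D}$ with boundary function $f^{*}$, and suppose that $f^{*}\in C(\mathbb{T})$ and that $\sup_{z\in\overline{\mathbb{D}}}|f(z)|\le M$, where $M$ is a constant. If $f$ maps $\mathbb{D}$ into $\mathbb{D}$, then for all $z_1,z_2\in\mathbb{D}$, $$|f(z_1)-f(z_2)|\le\frac{\alpha+2}{c_\alpha}\,d_{h_{\mathbb{D}}}(z_1,z_2),$$ where $c_\alpha=\dfrac{(\Gamma(\frac{\alpha}{2}+1))^2}{\Gamma(\alpha+1)}$ and $d_{h_{\mathbb{D}}}$ is the hyperbolic distance of $\mathbb{D}$.
   Context: $\mathbb{D}=\{z\in\mathbb{C}:|z|<1\}$ and $\mathbb{T}=\partial\mathbb{D}$. $\Gamma(s)=\int_0^\infty t^{s-1}e^{-t}\,dt$ $(s>0)$ is the Gamma function. Put $\frac{\partial}{\partial z}=\frac12\left(\frac{\partial}{\partial x}-i\frac{\partial}{\partial y}\right)$ and $\frac{\partial}{\partial\overline z}=\frac12\left(\frac{\partial}{\partial x}+i\frac{\partial}{\partial y}\right)$. For $\alpha>-1$, a complex-valued function $f$ is $\alpha$-harmonic in $\mathbb{D}$ if it is twice continuously differentiable in $\mathbb{D}$ and satisfies $\frac{\partial}{\partial z}\left((1-|z|^2)^{-\alpha}\frac{\partial f}{\partial\overline z}\right)=0$ in $\mathbb{D}$. Standing assumption: every $\alpha$-harmonic function $f$ considered has a boundary function $f^*$, in the sense that $f_r\to f^*$ in $\mathcal{D}'(\mathbb{T})$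 as $r\to1^-$, where $f_r(e^{i\theta})=f(re^{i\theta})$, and is represented in $\mathbb{D}$ by $$f(z)=\frac1{2\pi}\int_0^{2\pi}\mathcal{P}_\alpha(ze^{-i\theta})f^*(e^{i\theta})\,d\theta,\qquad \mathcal{P}_\alpha(z)=\frac{(1-|z|^2)^{\alpha+1}}{(1-z)(1-\overline z)^{\alpha+1}}.$$ On $\mathbb{T}$ the values of $f$ are those of $f^*$. The hyperbolic distance on $\mathbb{D}$ (curvature $-1$) is $d_{h_{\mathbb{D}}}(z_1,z_2)=\inf_\gamma\int_\gamma\frac{2}{1-|z|^2}|dz|$, the infimum being over all rectifiable curves $\gamma$ in $\mathbb{D}$ connecting $z_1$ and $z_2$; explicitly, $$d_{h_{\mathbb{D}}}(z_1,z_2)=\log\frac{|1-z_1\overline{z}_2|+|z_1-z_2|}{|1-z_1\overline{z}_2|-|z_1-z_2|}.$$ *)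

(* Defs.v *)
From Stdlib Require Import Reals.
From Coquelicot Require Export Coquelicot.

Open Scope R_scope.

Definition unit_disk (z : C) : Prop := Cmod z < 1.
Definition unit_circle (z : C) : Prop := Cmod z = 1.

(* e^{it} *)
Definition cis (t : R) : C := (cos t, sin t).

Definition Gamma (s : R) : R :=
  RInt_gen (fun t => Rpower t (s - 1) * exp (- t))
    (at_right 0) (Rbar_locally p_infty).

Definition c_const (alpha : R) : R :=
  (Gamma (alpha / 2 + 1)) ^ 2 / Gamma (alpha + 1).

(* Principal argument, in (-PI, PI], of w <> 0. *)
Definition Arg (w : C) : R :=
  if Rle_dec 0 (Im w) then acos (Re w / Cmod w) else - acos (Re w / Cmod w).

(* Principal branch of w^a for w <> 0. *)
Definition Cpow (w : C) (a : R) : C :=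
  (RtoC (Rpower (Cmod w) a) * cis (a * Arg w))%C.

Definition CDerive (g : R -> C) (t : R) : C :=
  (Derive (fun s => Re (g s)) t, Derive (fun s => Im (g s)) t).

Definition ex_CDerive (g : R -> C) (t : R) : Prop :=
  @ex_derive R_AbsRing C_R_NormedModule g t.

Definition partial_x (f : C -> C) (z : C) : C :=
  CDerive (fun t => f (t, Im z)) (Re z).
Definition partial_y (f : C -> C) (z : C) : C :=
  CDerive (fun t => f (Re z, t)) (Im z).

Definition C1_on (D : C -> Prop) (f : C -> C) : Prop :=
  (forall z, D z -> ex_CDerive (fun t => f (t, Im z)) (Re z)
                 /\ ex_CDerive (fun t => f (Re z, t)) (Im z))
  /\ continuous_on D (partial_x f) /\ continuous_on D (partial_y f).

Definition C2_on (D : C -> Prop) (f : C -> C) : Prop :=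
  C1_on D f /\ C1_on D (partial_x f) /\ C1_on D (partial_y f).

Definition d_z (f : C -> C) (z : C) : C :=
  ((partial_x f z - Ci * partial_y f z) / RtoC 2)%C.
Definition d_zbar (f : C -> C) (z : C) : C :=
  ((partial_x f z + Ci * partial_y f z) / RtoC 2)%C.

Definition alpha_harmonic (alpha : R) (f : C -> C) : Prop :=
  C2_on unit_disk f /\
  forall z, unit_disk z ->
    d_z (fun w => (RtoC (Rpower (1 - Cmod w ^ 2) (- alpha)) * d_zbar f w)%C) z
    = RtoC 0.

Definition CInt (g : R -> C) (a b : R) : C :=
  @RInt C_R_CompleteNormedModule g a b.

(* Only the values of phi on the unit circle matter. *)
Definition test_function (phi : C -> C) : Prop :=
  forall (n : nat) (t : R),
    ex_derive_n (fun s => Re (phi (cis s))) n t /\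
    ex_derive_n (fun s => Im (phi (cis s))) n t.

Definition circle_pairing (g phi : C -> C) : C :=
  CInt (fun t => (g (cis t) * phi (cis t))%C) 0 (2 * PI).

(* f_r -> fstar in D'(T) as r -> 1-, for an integrable fstar. *)
Definition distributional_boundary_limit (f fstar : C -> C) : Prop :=
  forall phi, test_function phi ->
    filterlim (fun r : R => circle_pairing (fun z => f (RtoC r * z)%C) phi)
      (at_left 1) (locally (circle_pairing fstar phi)).

Definition P_kernel (alpha : R) (z : C) : C :=
  (RtoC (Rpower (1 - Cmod z ^ 2) (alpha + 1))
     / ((RtoC 1 - z) * Cpow (RtoC 1 - Cconj z) (alpha + 1)))%C.

Definition poisson_represented (alpha : R) (f fstar : C -> C) : Prop :=
  forall z, unit_disk z ->
    f z = (RtoC (/ (2 * PI)) *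
           CInt (fun t => (P_kernel alpha (z * cis (- t)) * fstar (cis t))%C)
             0 (2 * PI))%C.

Definition boundary_function (alpha : R) (f fstar : C -> C) : Prop :=
  distributional_boundary_limit f fstar /\ poisson_represented alpha f fstar.

(* f on the closed disk, its values on the circle being those of fstar. *)
Definition with_boundary (f fstar : C -> C) (z : C) : C :=
  if Rlt_dec (Cmod z) 1 then f z else fstar z.

(* 0 = x_0 <= x_1 <= ... <= x_{n+1} = 1 *)
Definition subdivision (n : nat) (x : nat -> R) : Prop :=
  x 0%nat = 0 /\ x (S n) = 1 /\ forall i, (i <= n)%nat -> x i <= x (S i).

Definition chord (gamma : R -> C) (x : nat -> R) (i : nat) : R :=
  Cmod (gamma (x (S i)) - gamma (x i))%C.

Definition rectifiable (gamma : R -> C) : Prop :=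
  exists L : R, forall n x, subdivision n x -> sum_n (chord gamma x) n <= L.

(* I is the line integral of rho |dz| along gamma : [0,1] -> C, as the limit of
   sums of rho(gamma(xi_i)) |gamma(x_{i+1}) - gamma(x_i)|; for a rectifiable
   gamma and a continuous rho this is the integral with respect to arc length. *)
Definition is_arc_integral (rho : C -> R) (gamma : R -> C) (I : R) : Prop :=
  forall eps, 0 < eps -> exists delta, 0 < delta /\
    forall n x xi, subdivision n x ->
      (forall i, (i <= n)%nat ->
         x i <= xi i <= x (S i) /\ x (S i) - x i < delta) ->
      Rabs (sum_n (fun i => rho (gamma (xi i)) * chord gamma x i) n - I) < eps.

Definition curve_in (D : C -> Prop) (z1 z2 : C) (gamma : R -> C) : Prop :=
  continuous_on (fun t : R => 0 <= t <= 1) gamma /\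
  (forall t, 0 <= t <= 1 -> D (gamma t)) /\
  gamma 0 = z1 /\ gamma 1 = z2.

(* For z1, z2 in the disk the set of lengths is nonempty (segments) and bounded
   below by 0, so its infimum in Rbar is finite. *)
Definition hyperbolic_dist (z1 z2 : C) : R :=
  real (Glb_Rbar (fun L : R => exists gamma : R -> C,
    curve_in unit_disk z1 z2 gamma /\ rectifiable gamma /\
    is_arc_integral (fun z => 2 / (1 - Cmod z ^ 2)) gamma L)).

(* Main.v *)
(* The Poisson kernel is exp L with L = (alpha+1) log(1-|z|^2) - log(1-z) - (alpha+1) log(1-conj z),
   and |L_z| + |L_zbar| <= (alpha + 2 + |alpha|) / (1 - |z|^2) <= (alpha + 2) rho(z), where
   rho = 2 / (1 - |z|^2).  As |f*| <= 1, which follows from |f| < 1 by testing the distributional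
   limit against powers of cos^2((t - t0)/2), f is infinitesimally Lipschitz for the metric rho |dz|
   with constant (alpha + 2) times the supremum of the means of |P_alpha|, and the estimate sums
   along curves.

   With s = alpha/2 + 1, expanding (1-z)^(-s) and using Parseval, the mean of |P_alpha| on |z| = r is
   (1-r^2)^(2s-1) sum_n ((s)_n/n!)^2 r^(2n).  Midpoint log-convexity, Gamma(s+n)^2 <=
   Gamma(n+1) Gamma(2s-1+n), bounds the series termwise by Gamma(2s-1)/Gamma(s)^2 times the binomial
   series of (1-r^2)^(-(2s-1)); so the mean is at most 1/c_alpha.  Only Taylor polynomials are used,
   with a remainder that is uniform on |z| = r. *)
Require Import Defs.
From Stdlib Require Import Reals Lra Lia Psatz Factorial Classical.
From Coquelicot Require Import Coquelicot.
Open Scope R_scope.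

(** * The Gamma function *)

(** Curves are only continuous and [is_arc_integral] is a limit of sums, so nothing is
    differentiated along a curve or under the integral sign: all estimates concern finite
    increments. The increment of the kernel is taken relatively, P(z + d) - P(z) = P(z) (exp w - 1),
    with w the increment of L. The bound on w does not see the boundary point, because 1/(1 - z)
    survives in the derivatives of L only through unimodular quotients of 1 - z and its conjugate.
    The boundary point is felt in the factor |P(z)| alone, whose mean is bounded once and for all,
    while |exp w - 1| <= |w| exp |w| costs a factor that tends to 1 with the mesh.

    Nothing is lost as r -> 1 in the termwise comparison: both coefficient sequences are of order
    n^(2s-2), and the constant Gamma(2s-1)/Gamma(s)^2 is the limit of their quotient.

    The a priori bound [M] serves to prove that f is continuous on inner circles, which makes the
    pairings with test functions true integrals; after that the bound 1 takes its place. *)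

Definition gamma_density (s t : R) : R := Rpower t (s - 1) * exp (- t).

Lemma gamma_density_pos (s t : R) : 0 < gamma_density s t.
Proof. apply Rmult_lt_0_compat; apply exp_pos. Qed.

Lemma gamma_density_continuous (s t : R) :
  0 < t -> continuous (gamma_density s) t.
Proof.
  intros Ht. apply (ex_derive_continuous (gamma_density s)).
  unfold gamma_density, Rpower. auto_derive. exact Ht.
Qed.

Lemma gamma_density_ex_RInt (s a b : R) :
  0 < a -> 0 < b -> ex_RInt (gamma_density s) a b.
Proof.
  intros Ha Hb. apply (ex_RInt_continuous (gamma_density s)).
  intros t Ht. apply gamma_density_continuous.
  apply Rlt_le_trans with (2 := proj1 Ht). now apply Rmin_glb_lt.
Qed.

Lemma RInt_gamma_density_mono (s a' a b b' : R) :
  0 < a' <= a -> a <= b -> b <= b' ->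
  RInt (gamma_density s) a b <= RInt (gamma_density s) a' b'.
Proof.
  intros Ha Hab Hb.
  rewrite <- (RInt_Chasles (gamma_density s) a' a b') by
    (apply gamma_density_ex_RInt; lra).
  rewrite <- (RInt_Chasles (gamma_density s) a b b') by
    (apply gamma_density_ex_RInt; lra).
  assert (H : forall u v, 0 < u <= v -> 0 <= RInt (gamma_density s) u v).
  { intros u v Huv. apply RInt_ge_0; [lra | apply gamma_density_ex_RInt; lra |].
    intros; left; apply gamma_density_pos. }
  assert (H1 := H a' a ltac:(lra)). assert (H2 := H b b' ltac:(lra)).
  unfold plus; simpl. lra.
Qed.

(** Apply ln y <= y to y = t / (2 (p + 1)): the scale is chosen so that p y <= t / 2, which leaves
    half of the exponential decay. *)
Lemma Rpower_exp_neg_le (p t : R) : 0 <= p -> 0 < t ->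
  Rpower t p * exp (- t) <= exp (p * ln (2 * (p + 1))) * exp (- t / 2).
Proof.
  intros Hp Ht. unfold Rpower. rewrite <- !exp_plus.
  assert (H : p * ln t <= t / 2 + p * ln (2 * (p + 1))).
  { assert (Hy : 0 < t / (2 * (p + 1))) by (apply Rdiv_lt_0_compat; lra).
    assert (Hl : ln (t / (2 * (p + 1))) <= t / (2 * (p + 1))).
    { rewrite <- (exp_ln (t / (2 * (p + 1)))) at 2 by exact Hy.
      assert (H := exp_ineq1_le (ln (t / (2 * (p + 1))))). lra. }
    replace t with (t / (2 * (p + 1)) * (2 * (p + 1))) at 1 by (field; lra).
    rewrite ln_mult by lra.
    rewrite Rmult_plus_distr_l. apply Rplus_le_compat_r.
    apply Rle_trans with (p * (t / (2 * (p + 1)))).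
    { now apply Rmult_le_compat_l. }
    apply Rmult_le_reg_r with (2 * (p + 1)); [lra |].
    replace (p * (t / (2 * (p + 1))) * (2 * (p + 1))) with (p * t) by (field; lra).
    nra. }
  assert (H' : p * ln t + - t <= p * ln (2 * (p + 1)) + - t / 2) by lra.
  destruct H' as [H' | H']; [left; now apply exp_increasing | right; now f_equal].
Qed.

Lemma Rpower_exp_neg_bounded (p : R) : 0 < p -> exists C, 0 < C /\
  forall t, 0 < t -> Rpower t p * exp (- t) <= C * exp (- t / 2).
Proof.
  intros Hp. exists (exp (p * ln (2 * (p + 1)))). split; [apply exp_pos |].
  intros t Ht. apply Rpower_exp_neg_le; lra.
Qed.

Lemma RInt_gamma_density_bounded (s : R) : 0 < s ->
  exists B, forall a b, 0 < a <= b -> RInt (gamma_density s) a b <= B.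
Proof.
  intros Hs.
  destruct (Rpower_exp_neg_bounded s Hs) as [C [HC HCt]].
  exists (/ s + 2 * C).
  intros a b Hab.
  (* The interval is enlarged until it contains 1. Left of 1 the exponential is dropped and t^(s-1)
     is integrated exactly; right of 1, t^(s-1) <= t^s and the decay exp(-t/2) takes over. *)
  set (a' := Rmin a 1). set (b' := Rmax b 1).
  assert (Ha' : 0 < a' <= 1 /\ a' <= a).
  { unfold a'. split; [split|]. apply Rmin_glb_lt; lra. apply Rmin_r. apply Rmin_l. }
  assert (Hb' : b <= b' /\ 1 <= b').
  { unfold b'. split. apply Rmax_l. apply Rmax_r. }
  apply Rle_trans with (RInt (gamma_density s) a' b').
  { apply RInt_gamma_density_mono; lra. }
  rewrite <- (RInt_Chasles (gamma_density s) a' 1 b') by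
    (apply gamma_density_ex_RInt; lra).
  apply Rplus_le_compat.
  - assert (I : is_RInt (fun t => Rpower t (s - 1)) a' 1
      (minus (Rpower 1 s / s) (Rpower a' s / s))).
    { apply (is_RInt_derive (fun t => Rpower t s / s)).
      - intros t Ht. rewrite Rmin_left in Ht by lra.
        assert (0 < t) by lra.
        replace (Rpower t (s - 1)) with (Rpower t s / t).
        + unfold Rpower. auto_derive; [lra|]. field. lra.
        + unfold Rminus. rewrite Rpower_plus, Rpower_Ropp, Rpower_1 by lra. reflexivity.
      - intros t Ht. rewrite Rmin_left in Ht by lra.
        apply (ex_derive_continuous (fun t => Rpower t (s - 1))).
        unfold Rpower. auto_derive. lra. }
    apply Rle_trans with (RInt (fun t => Rpower t (s - 1)) a' 1).
    + apply RInt_le; [lra | apply gamma_density_ex_RInt; lra | eexists; exact I |].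
      intros t Ht. unfold gamma_density.
      rewrite <- (Rmult_1_r (Rpower t (s - 1))) at 2.
      apply Rmult_le_compat_l; [left; apply exp_pos |].
      rewrite <- exp_0. left. apply exp_increasing. lra.
    + rewrite (is_RInt_unique _ _ _ _ I). unfold minus, plus, opp; simpl.
      replace (Rpower 1 s) with 1 by (unfold Rpower; rewrite ln_1, Rmult_0_r, exp_0; reflexivity).
      assert (0 < Rpower a' s / s) by (apply Rdiv_lt_0_compat; [apply exp_pos | lra]).
      lra.
  - assert (I : is_RInt (fun t => C * exp (- t / 2)) 1 b'
      (minus (- 2 * C * exp (- b' / 2)) (- 2 * C * exp (- 1 / 2)))).
    { apply (is_RInt_derive (fun t => - 2 * C * exp (- t / 2))).
      - intros t Ht. auto_derive; [trivial|]. unfold Rdiv. field.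
      - intros t Ht. apply (ex_derive_continuous (fun t => C * exp (- t / 2))).
        auto_derive. trivial. }
    apply Rle_trans with (RInt (fun t => C * exp (- t / 2)) 1 b').
    + apply RInt_le; [lra | apply gamma_density_ex_RInt; lra | eexists; exact I |].
      intros t Ht. apply Rle_trans with (2 := HCt t ltac:(lra)).
      unfold gamma_density. apply Rmult_le_compat_r; [left; apply exp_pos |].
      apply Rle_Rpower; lra.
    + rewrite (is_RInt_unique _ _ _ _ I). unfold minus, plus, opp; simpl.
      assert (0 < exp (- b' / 2)) by apply exp_pos.
      assert (exp (- 1 / 2) <= 1) by (rewrite <- exp_0; left; apply exp_increasing; lra).
      nra.
Qed.

(** The density is positive, so proper integrals grow with the interval and the improper integral is
    their supremum. Every later fact about [Gamma] is thereby reduced to integrals over compact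
    intervals. *)
Lemma Gamma_is_lub (s : R) : 0 < s ->
  is_lub (fun I => exists a b, 0 < a <= b /\ I = RInt (gamma_density s) a b) (Gamma s).
Proof.
  intros Hs.
  set (E := fun I => exists a b, 0 < a <= b /\ I = RInt (gamma_density s) a b).
  destruct (completeness E) as [L [HL1 HL2]].
  { destruct (RInt_gamma_density_bounded s Hs) as [B HB].
    exists B. intros I [a [b [Hab ->]]]. now apply HB. }
  { exists (RInt (gamma_density s) 1 1), 1, 1. split; [lra | reflexivity]. }
  replace (Gamma s) with L; [now split |].
  symmetry. apply is_RInt_gen_unique.
  apply (filterlimi_locally
    (fun ab : R * R => is_RInt (gamma_density s) (fst ab) (snd ab)) L).
  intros eps.
  assert (Hex : exists a b, 0 < a <= b /\ L - eps < RInt (gamma_density s) a b).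
  { destruct (classic
      (exists a b, 0 < a <= b /\ L - eps < RInt (gamma_density s) a b)) as [H | H]; [exact H |].
    exfalso. assert (L <= L - eps).
    { apply HL2. intros I [a [b [Hab ->]]]. apply Rnot_lt_le. intros Hlt.
      apply H. now exists a, b. }
    destruct eps as [e He]; simpl in *. lra. }
  destruct Hex as [a [b [Hab Hlt]]].
  apply Filter_prod with (Q := fun x => 0 < x < a) (R := fun y => b < y).
  - exists (mkposreal a (proj1 Hab)). intros y Hy Hy0. split; [exact Hy0 |].
    change (Rabs (y - 0) < a) in Hy. apply Rabs_def2 in Hy. lra.
  - exists b. intros y Hy. exact Hy.
  - intros x y Hx Hy. simpl. exists (RInt (gamma_density s) x y). split.
    + apply (RInt_correct (gamma_density s)). apply gamma_density_ex_RInt; lra.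
    + assert (H1 : RInt (gamma_density s) x y <= L) by (apply HL1; exists x, y; split; [lra | reflexivity]).
      assert (H2 := RInt_gamma_density_mono s x a b y ltac:(lra) ltac:(lra) ltac:(lra)).
      change (Rabs (RInt (gamma_density s) x y - L) < eps). apply Rabs_def1; lra.
Qed.

Lemma RInt_gamma_density_le_Gamma (s a b : R) :
  0 < s -> 0 < a <= b -> RInt (gamma_density s) a b <= Gamma s.
Proof. intros Hs Hab. apply (proj1 (Gamma_is_lub s Hs)). now exists a, b. Qed.

Lemma Gamma_le (s U : R) : 0 < s ->
  (forall a b, 0 < a <= b -> RInt (gamma_density s) a b <= U) -> Gamma s <= U.
Proof.
  intros Hs HU. apply (proj2 (Gamma_is_lub s Hs)).
  intros I [a [b [Hab ->]]]. now apply HU.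
Qed.

Lemma Gamma_pos (s : R) : 0 < s -> 0 < Gamma s.
Proof.
  intros Hs. apply Rlt_le_trans with (RInt (gamma_density s) 1 2).
  - apply RInt_gt_0; [lra | intros; apply gamma_density_pos |].
    intros. apply gamma_density_continuous. lra.
  - apply RInt_gamma_density_le_Gamma; lra.
Qed.

(** Integration by parts, from the primitive -t^s exp(-t). The boundary terms are kept; in each half
    of [Gamma_succ] one has a favourable sign and the other is made small. *)
Lemma RInt_gamma_density_succ (s a b : R) : 0 < s -> 0 < a <= b ->
  RInt (gamma_density (s + 1)) a b
  = s * RInt (gamma_density s) a b + Rpower a s * exp (- a) - Rpower b s * exp (- b).
Proof.
  intros Hs Hab.
  assert (I : is_RInt (fun t => gamma_density (s + 1) t - s * gamma_density s t) a b
    (minus (- (Rpower b s * exp (- b))) (- (Rpower a s * exp (- a))))).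
  { apply (is_RInt_derive (fun t => - (Rpower t s * exp (- t)))).
    - intros t Ht. rewrite Rmin_left in Ht by lra. unfold gamma_density.
      replace (s + 1 - 1) with s by ring.
      replace (Rpower t (s - 1)) with (Rpower t s / t).
      + unfold Rpower. auto_derive; [lra|]. field. lra.
      + unfold Rminus. rewrite Rpower_plus, Rpower_Ropp, Rpower_1 by lra. reflexivity.
    - intros t Ht. rewrite Rmin_left in Ht by lra.
      apply (ex_derive_continuous (fun t => gamma_density (s + 1) t - s * gamma_density s t)).
      unfold gamma_density, Rpower. auto_derive. lra. }
  apply (is_RInt_unique (V := R_CompleteNormedModule)) in I.
  rewrite (RInt_minus (gamma_density (s + 1)) (fun t => s * gamma_density s t)) in I.
  - rewrite (RInt_scal (gamma_density s)) in I by (apply gamma_density_ex_RInt; lra).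
    unfold minus, plus, opp, scal in I; simpl in I. unfold mult in I; simpl in I. lra.
  - apply gamma_density_ex_RInt; lra.
  - apply (ex_RInt_scal (gamma_density s)). apply gamma_density_ex_RInt; lra.
Qed.

Lemma Rpower_inv_r (eps s : R) : 0 < eps -> 0 < s -> Rpower (Rpower eps (/ s)) s = eps.
Proof.
  intros He Hs. rewrite Rpower_mult, Rinv_l by lra. now apply Rpower_1.
Qed.

Lemma Gamma_succ (s : R) : 0 < s -> Gamma (s + 1) = s * Gamma s.
Proof.
  intros Hs. apply Rle_antisym.
  - apply Gamma_le; [lra |]. intros a b Hab. apply le_epsilon. intros eps He.
    (* Moving the left endpoint down only increases the integral, and this value gives a'^s <=
       eps. *)
    set (a' := Rmin a (Rpower eps (/ s))).
    assert (Ha' : 0 < a' <= a /\ a' <= Rpower eps (/ s)).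
    { unfold a'. split; [split|]. apply Rmin_glb_lt; [lra | apply exp_pos].
      apply Rmin_l. apply Rmin_r. }
    apply Rle_trans with (1 := RInt_gamma_density_mono (s + 1) a' a b b
      ltac:(lra) ltac:(lra) ltac:(lra)).
    rewrite RInt_gamma_density_succ by lra.
    assert (H1 := RInt_gamma_density_le_Gamma s a' b Hs ltac:(lra)).
    assert (H2 : 0 < Rpower b s * exp (- b)) by (apply Rmult_lt_0_compat; apply exp_pos).
    assert (H3 : Rpower a' s * exp (- a') <= eps * 1).
    { apply Rmult_le_compat; try (left; apply exp_pos).
      - rewrite <- (Rpower_inv_r eps s) by lra. apply Rle_Rpower_l; lra.
      - rewrite <- exp_0. left. apply exp_increasing. lra. }
    nra.
  - assert (H : Gamma s <= Gamma (s + 1) / s).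
    { apply Gamma_le; [lra |]. intros a b Hab. apply Rmult_le_reg_l with s; [lra |].
      replace (s * (Gamma (s + 1) / s)) with (Gamma (s + 1)) by (field; lra).
      apply le_epsilon. intros eps He.
      destruct (Rpower_exp_neg_bounded s Hs) as [C [HC HCt]].
      (* The boundary term is at most C exp(-b'/2), and exp(b'/2) >= 1 + b'/2 exceeds C / eps. *)
      set (b' := Rmax b (2 * (C / eps))).
      assert (Hb' : b <= b' /\ 2 * (C / eps) <= b').
      { unfold b'. split. apply Rmax_l. apply Rmax_r. }
      assert (Hce : 0 < C / eps) by (apply Rdiv_lt_0_compat; lra).
      assert (H1 := RInt_gamma_density_mono s a a b b' ltac:(lra) ltac:(lra) ltac:(lra)).
      assert (H2 := RInt_gamma_density_succ s a b' Hs ltac:(lra)).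
      assert (H3 := RInt_gamma_density_le_Gamma (s + 1) a b' ltac:(lra) ltac:(lra)).
      assert (H4 : 0 < Rpower a s * exp (- a)) by (apply Rmult_lt_0_compat; apply exp_pos).
      assert (H5 : Rpower b' s * exp (- b') <= eps).
      { apply Rle_trans with (1 := HCt b' ltac:(lra)).
        replace (- b' / 2) with (- (b' / 2)) by field. rewrite exp_Ropp.
        assert (H6 := exp_ineq1_le (b' / 2)).
        apply Rmult_le_reg_r with (exp (b' / 2)); [apply exp_pos |].
        rewrite Rmult_assoc, Rinv_l by (apply Rgt_not_eq, exp_pos).
        assert (C = eps * (C / eps)) by (field; lra). nra. }
      nra. }
    apply Rmult_le_compat_l with (r := s) in H; [|lra].
    replace (s * (Gamma (s + 1) / s)) with (Gamma (s + 1)) in H by (field; lra). exact H.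
Qed.

Lemma Gamma_1_le : Gamma 1 <= 1.
Proof.
  apply Gamma_le; [lra |]. intros a b Hab.
  assert (I : is_RInt (gamma_density 1) a b (minus (- exp (- b)) (- exp (- a)))).
  { apply (is_RInt_derive (fun t => - exp (- t))).
    - intros t Ht. rewrite Rmin_left in Ht by lra. unfold gamma_density.
      replace (1 - 1) with 0 by ring. rewrite Rpower_O by lra.
      auto_derive; [trivial | ring].
    - intros t Ht. rewrite Rmin_left in Ht by lra. apply gamma_density_continuous. lra. }
  rewrite (is_RInt_unique _ _ _ _ I). unfold minus, plus, opp; simpl.
  assert (0 < exp (- b)) by apply exp_pos.
  assert (exp (- a) <= 1) by (rewrite <- exp_0; left; apply exp_increasing; lra).
  lra.
Qed.

(** Cauchy-Schwarz for t^((p-1)/2) and t^((q-1)/2) under the weight exp(-t). The weights of the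
    pointwise inequality balance its two terms, so integrating it gives the geometric mean
    [u * v]. *)
Lemma Gamma_log_convex (p q : R) : 0 < p -> 0 < q ->
  Gamma ((p + q) / 2) ^ 2 <= Gamma p * Gamma q.
Proof.
  intros Hp Hq.
  assert (Gp := Gamma_pos p Hp). assert (Gq := Gamma_pos q Hq).
  assert (Gm := Gamma_pos ((p + q) / 2) ltac:(lra)).
  (* AM-GM with weights u = sqrt (Gamma q), v = sqrt (Gamma p):
     2 u v t^(m-1) <= u^2 t^(p-1) + v^2 t^(q-1) for m = (p+q)/2. *)
  set (u := sqrt (Gamma q)). set (v := sqrt (Gamma p)).
  assert (Hu : 0 < u) by (now apply sqrt_lt_R0).
  assert (Hv : 0 < v) by (now apply sqrt_lt_R0).
  assert (Hu2 : u * u = Gamma q) by (apply sqrt_sqrt; lra).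
  assert (Hv2 : v * v = Gamma p) by (apply sqrt_sqrt; lra).
  assert (H : Gamma ((p + q) / 2) <= (u * u * Gamma p + v * v * Gamma q) / (2 * (u * v))).
  { apply Gamma_le; [lra |]. intros a b Hab.
    apply Rmult_le_reg_l with (2 * (u * v)); [nra |].
    replace (2 * (u * v) * ((u * u * Gamma p + v * v * Gamma q) / (2 * (u * v))))
      with (u * u * Gamma p + v * v * Gamma q) by (field; split; lra).
    apply Rle_trans with (u * u * RInt (gamma_density p) a b + v * v * RInt (gamma_density q) a b).
    2:{ apply Rplus_le_compat; (apply Rmult_le_compat_l; [nra |]);
        apply RInt_gamma_density_le_Gamma; lra. }
    assert (E : forall s, ex_RInt (gamma_density s) a b)
      by (intros s; apply gamma_density_ex_RInt; lra).
    assert (S : forall s k, k * RInt (gamma_density s) a b = RInt (fun t => k * gamma_density s t) a b).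
    { intros s k. symmetry. apply (RInt_scal (gamma_density s)). apply E. }
    assert (Es : forall s k, ex_RInt (fun t => k * gamma_density s t) a b).
    { intros s k. apply (ex_RInt_scal (gamma_density s)). apply E. }
    rewrite !S.
    rewrite <- (RInt_plus (fun t => u * u * gamma_density p t)) by apply Es.
    apply RInt_le; [lra | apply Es | |].
    - apply (ex_RInt_plus (fun t => u * u * gamma_density p t)); apply Es.
    - intros t Ht. unfold plus, gamma_density; simpl.
      set (P := Rpower t ((p - 1) / 2)). set (Q := Rpower t ((q - 1) / 2)).
      replace (Rpower t ((p + q) / 2 - 1)) with (P * Q)
        by (unfold P, Q; rewrite <- Rpower_plus; f_equal; field).
      replace (Rpower t (p - 1)) with (P * P)
        by (unfold P; rewrite <- Rpower_plus; f_equal; field).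
      replace (Rpower t (q - 1)) with (Q * Q)
        by (unfold Q; rewrite <- Rpower_plus; f_equal; field).
      assert (0 < exp (- t)) by apply exp_pos.
      assert (0 <= (u * P - v * Q) ^ 2 * exp (- t))
        by (apply Rmult_le_pos; [apply pow2_ge_0 | lra]).
      nra. }
  rewrite <- Hu2, <- Hv2 in H |- *.
  replace ((u * u * (v * v) + v * v * (u * u)) / (2 * (u * v))) with (u * v) in H
    by (field; split; lra).
  simpl. nra.
Qed.

(** * Taylor polynomials of the binomial function *)

(* The Taylor coefficients [(s)_n / n!] of [(1 - z)^(-s)]. *)
Fixpoint binom_coef (s : R) (n : nat) : R :=
  match n with
  | O => 1
  | S k => binom_coef s k * (s + INR k) / INR (S k)
  end.

Lemma binom_coef_succ (s : R) (n : nat) :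
  INR (S n) * binom_coef s (S n) = (s + INR n) * binom_coef s n.
Proof. cbn [binom_coef]. field. apply not_0_INR. lia. Qed.

Lemma binom_coef_pos (s : R) (n : nat) : 0 < s -> 0 < binom_coef s n.
Proof.
  intros Hs. induction n as [|n IH]; [simpl; lra |].
  cbn [binom_coef]. assert (0 <= INR n) by apply pos_INR.
  apply Rdiv_lt_0_compat; [nra | apply lt_0_INR; lia].
Qed.

Lemma Gamma_shift (s : R) (n : nat) : 0 < s ->
  Gamma (s + INR n) = binom_coef s n * INR (fact n) * Gamma s.
Proof.
  intros Hs. induction n as [|n IH].
  - simpl. rewrite Rplus_0_r. ring.
  - assert (0 <= INR n) by apply pos_INR.
    rewrite S_INR. rewrite <- Rplus_assoc, Gamma_succ, IH by lra.
    rewrite fact_simpl, mult_INR.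
    replace (binom_coef s (S n) * (INR (S n) * INR (fact n)))
      with (INR (S n) * binom_coef s (S n) * INR (fact n)) by ring.
    rewrite binom_coef_succ. ring.
Qed.

(** This value enters on the larger side of log-convexity, so an upper bound is the useful
    direction. *)
Lemma Gamma_fact_le (n : nat) : Gamma (INR n + 1) <= INR (fact n).
Proof.
  induction n as [|n IH].
  - simpl. rewrite Rplus_0_l. exact Gamma_1_le.
  - assert (0 <= INR n) by apply pos_INR.
    rewrite S_INR, Gamma_succ, fact_simpl, mult_INR, S_INR by lra.
    apply Rmult_le_compat_l; lra.
Qed.

(* Log-convexity of Gamma at [s + n], the midpoint of [n + 1] and [2 s - 1 + n]. *)
Lemma binom_coef_sqr_le (s : R) (n : nat) : 1 / 2 < s ->
  binom_coef s n ^ 2 <= Gamma (2 * s - 1) / Gamma s ^ 2 * binom_coef (2 * s - 1) n.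
Proof.
  intros Hs. assert (Hn : 0 <= INR n) by apply pos_INR.
  assert (G := Gamma_pos s ltac:(lra)).
  assert (Gp := Gamma_pos (2 * s - 1) ltac:(lra)).
  assert (F : 0 < INR (fact n)) by apply INR_fact_lt_0.
  assert (B := binom_coef_pos (2 * s - 1) n ltac:(lra)).
  assert (H := Gamma_log_convex (INR n + 1) (2 * s - 1 + INR n) ltac:(lra) ltac:(lra)).
  replace ((INR n + 1 + (2 * s - 1 + INR n)) / 2) with (s + INR n) in H by field.
  rewrite !Gamma_shift in H by lra.
  assert (H' : (binom_coef s n * INR (fact n) * Gamma s) ^ 2
    <= INR (fact n) * (binom_coef (2 * s - 1) n * INR (fact n) * Gamma (2 * s - 1))).
  { apply Rle_trans with (1 := H). apply Rmult_le_compat_r; [| apply Gamma_fact_le].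
    left. repeat apply Rmult_lt_0_compat; assumption. }
  apply Rmult_le_reg_r with ((INR (fact n) * Gamma s) ^ 2); [apply pow_lt; nra |].
  replace (Gamma (2 * s - 1) / Gamma s ^ 2 * binom_coef (2 * s - 1) n * (INR (fact n) * Gamma s) ^ 2)
    with (INR (fact n) * (binom_coef (2 * s - 1) n * INR (fact n) * Gamma (2 * s - 1)))
    by (field; lra).
  lra.
Qed.

(* Real and imaginary parts of the Taylor polynomial of [(1 - z)^(-s)] at [z = r e^(i th)]. *)
Definition taylor_re (s th : R) (N : nat) (r : R) : R :=
  sum_f_R0 (fun n => binom_coef s n * r ^ n * cos (INR n * th)) N.
Definition taylor_im (s th : R) (N : nat) (r : R) : R :=
  sum_f_R0 (fun n => binom_coef s n * r ^ n * sin (INR n * th)) N.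
Definition taylor_re' (s th : R) (N : nat) (r : R) : R :=
  sum_f_R0 (fun n => binom_coef s n * (INR n * r ^ pred n) * cos (INR n * th)) N.
Definition taylor_im' (s th : R) (N : nat) (r : R) : R :=
  sum_f_R0 (fun n => binom_coef s n * (INR n * r ^ pred n) * sin (INR n * th)) N.

Lemma is_derive_power_sum (c : nat -> R) (N : nat) (g : nat -> R) (r : R) :
  is_derive (fun r => sum_f_R0 (fun n => c n * r ^ n * g n) N) r
    (sum_f_R0 (fun n => c n * (INR n * r ^ pred n) * g n) N).
Proof.
  induction N as [|N IH].
  - simpl. auto_derive; [trivial | ring].
  - cbn [sum_f_R0].
    apply (is_derive_plus (fun r => sum_f_R0 (fun n => c n * r ^ n * g n) N)
      (fun r => c (S N) * r ^ S N * g (S N))); [exact IH |].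
    auto_derive; [trivial |]. change (Nat.pred (S N)) with N. rewrite S_INR.
    destruct N; simpl; ring.
Qed.

(* With [h] the Taylor polynomial and [c_N] its last coefficient,
   [(1 - z) dh/dr = e^(i th) (s h - (s + N) c_N z^N)]. *)
Lemma taylor_ode (s th r : R) (N : nat) :
  (1 - r * cos th) * taylor_re' s th N r + r * sin th * taylor_im' s th N r
  = s * (cos th * taylor_re s th N r - sin th * taylor_im s th N r)
    - (s + INR N) * binom_coef s N * r ^ N * cos (INR (S N) * th)
  /\
  (1 - r * cos th) * taylor_im' s th N r - r * sin th * taylor_re' s th N r
  = s * (sin th * taylor_re s th N r + cos th * taylor_im s th N r)
    - (s + INR N) * binom_coef s N * r ^ N * sin (INR (S N) * th).
Proof.
  unfold taylor_re, taylor_im, taylor_re', taylor_im'.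
  induction N as [|N [IH1 IH2]].
  - simpl. rewrite (Rmult_0_l th), (Rmult_1_l th), cos_0, sin_0. split; ring.
  - cbn [sum_f_R0]. cbn [pred].
    replace (INR (S (S N)) * th) with (INR (S N) * th + th) by (rewrite (S_INR (S N)); ring).
    rewrite cos_plus, sin_plus.
    (* The old remainder (s + N) c_N becomes (N + 1) c_(N+1), so that it cancels against the
       derivative of the term being added. *)
    rewrite <- (binom_coef_succ s N) in IH1, IH2.
    set (C := cos (INR (S N) * th)) in *. set (D := sin (INR (S N) * th)) in *.
    set (B := binom_coef s (S N)) in *. set (n := INR (S N)) in *.
    cbn [pow]. split.
    + match type of IH1 with _ * ?X + _ * ?Y = s * (_ * ?Z - _ * ?W) - _ =>
        set (U := X) in *; set (V := Y) in *; set (u := Z) in *; set (v := W) in * end.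
      transitivity ((1 - r * cos th) * U + r * sin th * V
         + ((1 - r * cos th) * (B * (n * r ^ N) * C) + r * sin th * (B * (n * r ^ N) * D))); [ring |].
      rewrite IH1. ring.
    + match type of IH2 with _ * ?X - _ * ?Y = s * (_ * ?Z + _ * ?W) - _ =>
        set (U := X) in *; set (V := Y) in *; set (u := Z) in *; set (v := W) in * end.
      transitivity ((1 - r * cos th) * U - r * sin th * V
         + ((1 - r * cos th) * (B * (n * r ^ N) * D) - r * sin th * (B * (n * r ^ N) * C))); [ring |].
      rewrite IH2. ring.
Qed.

Lemma Rpower_one (p : R) : Rpower 1 p = 1.
Proof. unfold Rpower. rewrite ln_1, Rmult_0_r. apply exp_0. Qed.

Lemma is_derive_Rpower_comp (g : R -> R) (p x g' : R) :
  is_derive g x g' -> 0 < g x ->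
  is_derive (fun x => Rpower (g x) p) x (p * Rpower (g x) (p - 1) * g').
Proof.
  intros Hg Hp.
  replace (p * Rpower (g x) (p - 1) * g') with (g' * (p * (Rpower (g x) p / g x))).
  - apply (is_derive_comp (fun y => Rpower y p) g); [| exact Hg].
    unfold Rpower. auto_derive; [exact Hp |]. field. lra.
  - unfold Rminus. rewrite Rpower_plus, Rpower_Ropp, Rpower_1 by exact Hp. field. lra.
Qed.

Lemma sum_binom_coef_pos (s x : R) (N : nat) : 0 < s -> 0 <= x ->
  0 <= sum_f_R0 (fun n => binom_coef s n * x ^ n) N.
Proof.
  intros Hs Hx. apply cond_pos_sum. intros k. apply Rmult_le_pos.
  - left. now apply binom_coef_pos.
  - now apply pow_le.
Qed.

(* [(1 - x)^s] times the partial sum is nonincreasing in [x]. *)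
Lemma sum_binom_coef_le (s x : R) (N : nat) : 0 < s -> 0 <= x < 1 ->
  sum_f_R0 (fun n => binom_coef s n * x ^ n) N <= Rpower (1 - x) (- s).
Proof.
  intros Hs Hx.
  set (S0 := fun x => sum_f_R0 (fun n => binom_coef s n * x ^ n) N).
  set (S' := fun x => sum_f_R0 (fun n => binom_coef s n * (INR n * x ^ pred n)) N).
  change (S0 x <= Rpower (1 - x) (- s)).
  assert (HS0 : S0 0 = 1).
  { unfold S0. clear. induction N as [|N IH]; simpl; [ring |].
    simpl in IH. rewrite IH. ring. }
  assert (Hd : forall y, is_derive S0 y (S' y)).
  { intros y. apply is_derive_ext with (fun r => sum_f_R0 (fun n => binom_coef s n * r ^ n * (fun _ => 1) n) N).
    - intros t. apply sum_eq. intros; ring.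
    - replace (S' y) with (sum_f_R0 (fun n => binom_coef s n * (INR n * y ^ pred n) * (fun _ => 1) n) N).
      + apply is_derive_power_sum.
      + apply sum_eq. intros; ring. }
  assert (Hode : forall y, (1 - y) * S' y = s * S0 y - (s + INR N) * binom_coef s N * y ^ N).
  { intros y. destruct (taylor_ode s 0 y N) as [H _].
    rewrite sin_0, cos_0, !Rmult_0_r, cos_0 in H.
    replace (taylor_re' s 0 N y) with (S' y) in H.
    replace (taylor_re s 0 N y) with (S0 y) in H.
    - lra.
    - apply sum_eq. intros. rewrite Rmult_0_r, cos_0. ring.
    - apply sum_eq. intros. rewrite Rmult_0_r, cos_0. ring. }
  assert (Hg : Rpower (1 - x) s * S0 x <= 1).
  { destruct (Req_dec x 0) as [-> | Hx0].
    - rewrite HS0, Rminus_0_r, Rpower_one. lra.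
    (* By [Hode] the derivative of the product collapses to minus (1 - y)^(s-1) times the remainder,
       which is nonpositive. *)
    - destruct (MVT_cor2 (fun y => Rpower (1 - y) s * S0 y)
        (fun y => - (Rpower (1 - y) (s - 1) * ((s + INR N) * binom_coef s N * y ^ N))) 0 x)
        as [c [Hc1 Hc2]]; [lra | |].
      + intros c Hc. apply is_derive_Reals.
        replace (- (Rpower (1 - c) (s - 1) * ((s + INR N) * binom_coef s N * c ^ N)))
          with (s * Rpower (1 - c) (s - 1) * (- 1) * S0 c + Rpower (1 - c) s * S' c).
        * apply (is_derive_mult (fun y => Rpower (1 - y) s) S0).
          -- apply (is_derive_Rpower_comp (fun y => 1 - y)); [| lra].
             auto_derive; [trivial | ring].
          -- apply Hd.
          -- intros; apply Rmult_comm.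
        * replace (Rpower (1 - c) s) with (Rpower (1 - c) (s - 1) * (1 - c)).
          -- assert (H := Hode c).
             replace (Rpower (1 - c) (s - 1) * (1 - c) * S' c)
               with (Rpower (1 - c) (s - 1) * ((1 - c) * S' c)) by ring.
             rewrite H. ring.
          -- rewrite <- (Rpower_1 (1 - c)) at 2 by lra. rewrite <- Rpower_plus. f_equal. ring.
      + rewrite HS0, Rminus_0_r, Rpower_one in Hc1.
        assert (0 <= Rpower (1 - c) (s - 1) * ((s + INR N) * binom_coef s N * c ^ N)).
        { apply Rmult_le_pos; [left; apply exp_pos |].
          assert (0 <= INR N) by apply pos_INR. assert (B := binom_coef_pos s N Hs).
          apply Rmult_le_pos; [nra | apply pow_le; lra]. }
        nra. }
  rewrite Rpower_Ropp.
  assert (P : 0 < Rpower (1 - x) s) by apply exp_pos.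
  apply Rmult_le_reg_l with (1 := P). rewrite Rinv_r by lra. exact Hg.
Qed.

(** Together with [binom_coef_succ] this is d/dz (1-z)^(-s) = s (1-z)^(-(s+1)), read off
    coefficientwise. It absorbs the growing factor of the remainder into a coefficient of another
    binomial series. *)
Lemma binom_coef_shift (s : R) (n : nat) :
  (s + INR n) * binom_coef s n = s * binom_coef (s + 1) n.
Proof.
  induction n as [|n IH]; [simpl; ring |].
  assert (INR n + 1 <> 0) by (assert (0 <= INR n) by apply pos_INR; lra).
  cbn [binom_coef].
  replace ((s + INR (S n)) * (binom_coef s n * (s + INR n) / INR (S n)))
    with ((s + INR (S n)) * ((s + INR n) * binom_coef s n) / INR (S n))
    by (rewrite S_INR; now field).
  rewrite IH, S_INR. now field.
Qed.

(** With r < q < 1, each term of the series for s + 1 at q is bounded by its sum; passing from q to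
    r leaves the geometric factor (r / q)^N. *)
Lemma taylor_remainder_to_0 (s r : R) : 0 < s -> 0 <= r < 1 ->
  is_lim_seq (fun N => (s + INR N) * binom_coef s N * r ^ N) 0.
Proof.
  intros Hs Hr. set (q := (1 + r) / 2).
  assert (Hq : r < q < 1 /\ 0 < q) by (unfold q; lra).
  set (B := Rpower (1 - q) (- (s + 1))).
  assert (Hb : forall n, binom_coef (s + 1) n * q ^ n <= B).
  { intros n. apply Rle_trans with (2 := sum_binom_coef_le (s + 1) q n ltac:(lra) ltac:(lra)).
    destruct n as [|n]; [right; reflexivity |]. cbn [sum_f_R0].
    assert (H := sum_binom_coef_pos (s + 1) q n ltac:(lra) ltac:(lra)). lra. }
  assert (Hrq : 0 <= r / q < 1).
  { split; [apply Rdiv_le_0_compat; lra |]. apply Rmult_lt_reg_r with q; [lra |].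
    unfold Rdiv. rewrite Rmult_assoc, Rinv_l; lra. }
  apply is_lim_seq_le_le with (fun _ => 0) (fun N => s * B * (r / q) ^ N);
    [| apply is_lim_seq_const |].
  - intros n. assert (P := binom_coef_pos (s + 1) n ltac:(lra)). rewrite binom_coef_shift.
    split; [apply Rmult_le_pos; [nra | apply pow_le; lra] |].
    replace (r ^ n) with (q ^ n * (r / q) ^ n)
      by (rewrite <- Rpow_mult_distr; f_equal; field; lra).
    assert (0 <= (r / q) ^ n) by (apply pow_le; lra).
    assert (Hbn := Hb n).
    replace (s * binom_coef (s + 1) n * (q ^ n * (r / q) ^ n))
      with (s * (binom_coef (s + 1) n * q ^ n) * (r / q) ^ n) by ring.
    apply Rmult_le_compat_r; [assumption |]. apply Rmult_le_compat_l; lra.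
  - replace (Finite 0) with (Rbar_mult (s * B) 0) by (simpl; f_equal; ring).
    apply is_lim_seq_scal_l. apply is_lim_seq_geom. rewrite Rabs_pos_eq; lra.
Qed.

(* [ring] when the carrier of the equation is a structure projection convertible to [R]. *)
Ltac ring_R := match goal with |- ?x = ?y => change (@eq R x y) end; ring.

(** * Parseval for the Taylor polynomials and the mean of |1 - z|^(-2s) *)

Lemma is_RInt_cos_shift (phi : R) (k : nat) : (0 < k)%nat ->
  is_RInt (fun t => cos (INR k * (phi - t))) 0 (2 * PI) 0.
Proof.
  intros Hk. assert (HK : INR k <> 0) by (apply not_0_INR; lia).
  assert (I : forall c, c <> 0 -> is_RInt (fun t => cos (c * (phi - t))) 0 (2 * PI)
    (minus (- sin (c * (phi - 2 * PI)) / c) (- sin (c * (phi - 0)) / c))).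
  { intros c Hc. apply (is_RInt_derive (fun t => - sin (c * (phi - t)) / c)).
    - intros t _. auto_derive; [trivial |]. unfold Rminus. field. exact Hc.
    - intros t _. apply (ex_derive_continuous (fun t => cos (c * (phi - t)))).
      auto_derive. trivial. }
  specialize (I _ HK).
  replace (sin (INR k * (phi - 0))) with (sin (INR k * (phi - 2 * PI))) in I.
  - unfold minus, plus, opp in I; simpl in I. now rewrite Rplus_opp_r in I.
  - rewrite <- (sin_period (INR k * (phi - 2 * PI)) k). f_equal. ring.
Qed.

(** The integrand is the real part of the polynomial times exp(-i M (phi - t)). Its n-th term is a
    multiple of cos((M - n)(phi - t)), a nonzero frequency since n <= N < M. *)
Lemma is_RInt_taylor_orthogonal (s phi r : R) (N M : nat) : (N < M)%nat ->
  is_RInt (fun t => taylor_re s (phi - t) N r * cos (INR M * (phi - t))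
    + taylor_im s (phi - t) N r * sin (INR M * (phi - t))) 0 (2 * PI) 0.
Proof.
  intros HNM.
  assert (E : forall n, (n <= N)%nat -> is_RInt (fun t => binom_coef s n * r ^ n *
    (cos (INR n * (phi - t)) * cos (INR M * (phi - t))
     + sin (INR n * (phi - t)) * sin (INR M * (phi - t)))) 0 (2 * PI) 0).
  { intros n Hn. replace 0 with (scal (binom_coef s n * r ^ n) 0) at 2
      by (unfold scal; simpl; unfold mult; simpl; ring).
    apply (is_RInt_scal (fun t => cos (INR n * (phi - t)) * cos (INR M * (phi - t))
     + sin (INR n * (phi - t)) * sin (INR M * (phi - t)))).
    apply is_RInt_ext with (2 := is_RInt_cos_shift phi (M - n) ltac:(lia)).
    intros t _. rewrite minus_INR by lia.
    replace ((INR M - INR n) * (phi - t)) with (INR M * (phi - t) - INR n * (phi - t)) by ring.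
    rewrite cos_minus. ring_R. }
  clear HNM. unfold taylor_re, taylor_im. induction N as [|N IH].
  - apply is_RInt_ext with (2 := E 0%nat ltac:(lia)).
    intros t _. simpl. ring_R.
  - replace 0 with (plus 0 0) at 2 by (unfold plus; simpl; ring).
    apply is_RInt_ext with (2 := is_RInt_plus _ _ _ _ _ _
      (IH (fun n Hn => E n ltac:(lia))) (E (S N) ltac:(lia))).
    intros t _. cbn [sum_f_R0]. unfold plus; cbn -[pow binom_coef INR].
    ring_R.
Qed.

(** By induction on the degree: a new top term k exp(i (N+1) (phi - t)) adds k^2 and a cross term,
    and the cross term integrates to 0 by orthogonality. *)
Lemma is_RInt_taylor_sqr (s phi r : R) (N : nat) :
  is_RInt (fun t => taylor_re s (phi - t) N r ^ 2 + taylor_im s (phi - t) N r ^ 2)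
    0 (2 * PI) (2 * PI * sum_f_R0 (fun n => (binom_coef s n * r ^ n) ^ 2) N).
Proof.
  induction N as [|N IH].
  - assert (I := is_RInt_const (V := R_NormedModule) 0 (2 * PI) 1).
    unfold scal in I; simpl in I; unfold mult in I; simpl in I.
    replace (2 * PI * sum_f_R0 (fun n => (binom_coef s n * r ^ n) ^ 2) 0)
      with ((2 * PI - 0) * 1) by (simpl; ring).
    apply is_RInt_ext with (2 := I). intros t _.
    unfold taylor_re, taylor_im; simpl. rewrite (Rmult_0_l (phi - t)), cos_0, sin_0. ring.
  - set (k := binom_coef s (S N) * r ^ S N).
    assert (I1 := is_RInt_scal _ _ _ (2 * k) _ (is_RInt_taylor_orthogonal s phi r N (S N) ltac:(lia))).
    assert (I2 := is_RInt_const (V := R_NormedModule) 0 (2 * PI) (k ^ 2)).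
    assert (I3 := is_RInt_plus _ _ _ _ _ _ IH (is_RInt_plus _ _ _ _ _ _ I1 I2)).
    unfold plus, scal in I3; cbn -[pow binom_coef INR sum_f_R0] in I3.
    unfold mult in I3; cbn -[pow binom_coef INR sum_f_R0] in I3.
    replace (2 * PI * sum_f_R0 (fun n => (binom_coef s n * r ^ n) ^ 2) (S N))
      with (2 * PI * sum_f_R0 (fun n => (binom_coef s n * r ^ n) ^ 2) N
            + (2 * k * 0 + (2 * PI - 0) * k ^ 2)) by (cbn [sum_f_R0]; fold k; ring).
    apply is_RInt_ext with (2 := I3). intros t _.
    unfold taylor_re, taylor_im. cbn [sum_f_R0]. fold k.
    set (th := INR (S N) * (phi - t)).
    assert (H := sin2_cos2 th). unfold Rsqr in H.
    replace (k ^ 2) with (k ^ 2 * (sin th * sin th + cos th * cos th)) by (rewrite H; ring).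
    ring_R.
Qed.

(* [|1 - r e^(i th)|^2] *)
Definition dist1_sqr (r th : R) : R := (1 - r * cos th) ^ 2 + (r * sin th) ^ 2.

Lemma dist1_sqr_bounds (r th : R) : 0 <= r < 1 ->
  (1 - r) ^ 2 <= dist1_sqr r th <= 4.
Proof.
  intros Hr. unfold dist1_sqr.
  assert (H := sin2_cos2 th). unfold Rsqr in H.
  replace ((1 - r * cos th) ^ 2 + (r * sin th) ^ 2) with (1 - 2 * r * cos th + r ^ 2).
  - assert (B := COS_bound th). nra.
  - replace (r ^ 2) with (r ^ 2 * (sin th * sin th + cos th * cos th)) by (rewrite H; ring).
    ring.
Qed.

Lemma sum_abs_le (s r : R) (g : nat -> R) (N : nat) : 0 < s -> 0 <= r < 1 ->
  (forall n, Rabs (g n) <= 1) ->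
  Rabs (sum_f_R0 (fun n => binom_coef s n * r ^ n * g n) N) <= Rpower (1 - r) (- s).
Proof.
  intros Hs Hr Hg.
  apply Rle_trans with (2 := sum_binom_coef_le s r N Hs Hr).
  apply Rle_trans with (1 := Rsum_abs _ N).
  apply sum_Rle. intros n _. assert (P := binom_coef_pos s n Hs).
  assert (Q : 0 <= r ^ n) by (apply pow_le; lra).
  assert (0 <= binom_coef s n * r ^ n) by nra.
  rewrite Rabs_mult, (Rabs_pos_eq (binom_coef s n * r ^ n)) by assumption.
  specialize (Hg n). nra.
Qed.

(* [|1 - z|^(2 s) |h(z)|^2] has derivative of the order of the remainder. *)
Lemma dist1_Rpower_le_taylor (s r : R) : 0 < s -> 0 <= r < 1 -> exists K, 0 <= K /\
  forall th N, Rpower (dist1_sqr r th) (- s)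
    <= taylor_re s th N r ^ 2 + taylor_im s th N r ^ 2
       + K * ((s + INR N) * binom_coef s N * r ^ N).
Proof.
  intros Hs Hr.
  (* On [0, r], [B] bounds both partial sums, [P] bounds the power s - 1 of [dist1_sqr] (written as
     the power s over the base, which settles s < 1 and s >= 1 alike), and [L] bounds the power -s.
     The factor 16 is 2 from the derivative, times 2 sums, times 4 for each trigonometric factor.
     None depends on [th] or [N]. *)
  set (B := Rpower (1 - r) (- s)). set (P := Rpower 4 s / (1 - r) ^ 2).
  set (L := Rpower ((1 - r) ^ 2) (- s)).
  assert (HB : 0 < B) by apply exp_pos. assert (HL : 0 < L) by apply exp_pos.
  assert (HP : 0 < P) by (apply Rdiv_lt_0_compat; [apply exp_pos | apply pow_lt; lra]).
  assert (HPB : 0 < 16 * P * B) by (apply Rmult_lt_0_compat; lra).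
  exists (L * (16 * P * B)). split; [left; now apply Rmult_lt_0_compat |]. intros th N.
  set (rem := fun y => (s + INR N) * binom_coef s N * y ^ N).
  change (Rpower (dist1_sqr r th) (- s)
    <= taylor_re s th N r ^ 2 + taylor_im s th N r ^ 2 + L * (16 * P * B) * rem r).
  assert (HN : 0 <= INR N) by apply pos_INR.
  assert (Hc := binom_coef_pos s N Hs).
  assert (Hrem : forall y, 0 <= y <= r -> 0 <= rem y <= rem r).
  { intros y Hy. unfold rem. split.
    - apply Rmult_le_pos; [nra | apply pow_le; lra].
    - apply Rmult_le_compat_l; [nra | apply pow_incr; lra]. }
  (* For h the polynomial and z = y e^(i th), [T] is [rem y] times the real part of conj(h) (1 -
     conj z) e^(i (N+1) th). It is what remains of the derivative of |(1-z)^s h|^2 once the terms in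
     s h cancel. *)
  set (T := fun y => rem y * (taylor_re s th N y
        * ((1 - y * cos th) * cos (INR (S N) * th) - y * sin th * sin (INR (S N) * th))
      + taylor_im s th N y
        * ((1 - y * cos th) * sin (INR (S N) * th) + y * sin th * cos (INR (S N) * th)))).
  set (D := fun y => Rpower (dist1_sqr y th) s * (taylor_re s th N y ^ 2 + taylor_im s th N y ^ 2)).
  set (D' := fun y => - 2 * (Rpower (dist1_sqr y th) (s - 1) * T y)).
  assert (Hpos : forall y, 0 <= y <= r -> 0 < (1 - r) ^ 2 <= dist1_sqr y th).
  { intros y Hy. split; [apply pow_lt; lra |].
    apply Rle_trans with (2 := proj1 (dist1_sqr_bounds y th ltac:(lra))). apply pow_incr; lra. }
  assert (HD : forall y, 0 <= y <= r -> is_derive D y (D' y)).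
  { intros y Hy. assert (Hp := Hpos y Hy).
    set (u := taylor_re s th N y). set (v := taylor_im s th N y).
    set (U := taylor_re' s th N y). set (V := taylor_im' s th N y).
    assert (Du : is_derive (fun y => taylor_re s th N y) y U)
      by apply (is_derive_power_sum (binom_coef s) N (fun n => cos (INR n * th))).
    assert (Dv : is_derive (fun y => taylor_im s th N y) y V)
      by apply (is_derive_power_sum (binom_coef s) N (fun n => sin (INR n * th))).
    assert (Drho : is_derive (fun y => dist1_sqr y th) y
      (- 2 * cos th * (1 - y * cos th) + 2 * sin th * (y * sin th))).
    { unfold dist1_sqr. auto_derive; [trivial | ring]. }
    replace (D' y) with
      (s * Rpower (dist1_sqr y th) (s - 1)
         * (- 2 * cos th * (1 - y * cos th) + 2 * sin th * (y * sin th)) * (u ^ 2 + v ^ 2)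
       + Rpower (dist1_sqr y th) s * (INR 2 * U * u ^ 1 + INR 2 * V * v ^ 1)).
    - apply (is_derive_mult (fun y => Rpower (dist1_sqr y th) s)
        (fun y => taylor_re s th N y ^ 2 + taylor_im s th N y ^ 2)).
      + apply (is_derive_Rpower_comp (fun y => dist1_sqr y th)); [exact Drho | lra].
      + apply (is_derive_plus (fun y => taylor_re s th N y ^ 2) (fun y => taylor_im s th N y ^ 2)).
        * now apply (is_derive_pow (fun y => taylor_re s th N y) 2).
        * now apply (is_derive_pow (fun y => taylor_im s th N y) 2).
      + intros; apply Rmult_comm.
    - replace (Rpower (dist1_sqr y th) s)
        with (Rpower (dist1_sqr y th) (s - 1) * dist1_sqr y th).
      2:{ rewrite <- (Rpower_1 (dist1_sqr y th)) at 2 by lra.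
          rewrite <- Rpower_plus. f_equal. ring. }
      destruct (taylor_ode s th y N) as [O1 O2].
      fold u v U V in O1, O2. unfold D', T. fold u v.
      fold (rem y) in O1, O2. unfold dist1_sqr.
      set (w := Rpower ((1 - y * cos th) ^ 2 + (y * sin th) ^ 2) (s - 1)).
      set (C := cos (INR (S N) * th)) in *. set (E := sin (INR (S N) * th)) in *.
      (* Multiplying the differential equation by 1 - conj z isolates |1-z|^2 dh/dy; [O] is the real
         part of its product with conj(h). *)
      assert (O : ((1 - y * cos th) ^ 2 + (y * sin th) ^ 2) * (U * u + V * v)
        = u * ((1 - y * cos th) * (s * (cos th * u - sin th * v) - rem y * C)
               - y * sin th * (s * (sin th * u + cos th * v) - rem y * E))
        + v * (y * sin th * (s * (cos th * u - sin th * v) - rem y * C)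
               + (1 - y * cos th) * (s * (sin th * u + cos th * v) - rem y * E))).
      { rewrite <- O1, <- O2. ring. }
      transitivity (w * (s * (- 2 * cos th * (1 - y * cos th) + 2 * sin th * (y * sin th)) * (u ^ 2 + v ^ 2)
        + 2 * (((1 - y * cos th) ^ 2 + (y * sin th) ^ 2) * (U * u + V * v)))).
      { simpl; ring. }
      rewrite O. ring. }
  assert (HT : forall y, 0 <= y <= r -> Rabs (D' y) <= 16 * P * B * rem r).
  { intros y Hy. assert (Hp := Hpos y Hy).
    assert (Hu : Rabs (taylor_re s th N y) <= B /\ Rabs (taylor_im s th N y) <= B).
    { assert (HyB : Rpower (1 - y) (- s) <= B).
      { unfold B. rewrite !Rpower_Ropp. apply Rinv_le_contravar; [apply exp_pos |].
        apply Rle_Rpower_l; lra. }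
      split; apply Rle_trans with (2 := HyB);
      [apply (sum_abs_le s y (fun n => cos (INR n * th))) |
       apply (sum_abs_le s y (fun n => sin (INR n * th)))]; try lra; intros n; apply Rabs_le;
      [apply COS_bound | apply SIN_bound]. }
    assert (Hw : Rpower (dist1_sqr y th) (s - 1) <= P).
    { unfold Rminus. rewrite Rpower_plus, Rpower_Ropp, Rpower_1 by lra.
      unfold P, Rdiv. apply Rmult_le_compat; try (left; apply exp_pos).
      - left. apply Rinv_0_lt_compat. lra.
      - apply Rle_Rpower_l; [lra |]. split; [lra |]. apply dist1_sqr_bounds; lra.
      - apply Rinv_le_contravar; lra. }
    assert (Htrig : forall a b c d, Rabs a <= 2 -> Rabs b <= 2 -> Rabs c <= 1 -> Rabs d <= 1 ->
      Rabs (a * c + b * d) <= 4).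
    { intros a b c d Ha Hb Hc' Hd. apply Rle_trans with (1 := Rabs_triang _ _).
      rewrite !Rabs_mult.
      assert (0 <= Rabs a) by apply Rabs_pos. assert (0 <= Rabs b) by apply Rabs_pos.
      assert (0 <= Rabs c) by apply Rabs_pos. assert (0 <= Rabs d) by apply Rabs_pos.
      nra. }
    assert (Ha : Rabs (1 - y * cos th) <= 2).
    { assert (H := COS_bound th). apply Rabs_le. nra. }
    assert (Hb : Rabs (y * sin th) <= 2).
    { assert (H := SIN_bound th). apply Rabs_le. nra. }
    assert (HC : Rabs (cos (INR (S N) * th)) <= 1) by (apply Rabs_le, COS_bound).
    assert (HE : Rabs (sin (INR (S N) * th)) <= 1) by (apply Rabs_le, SIN_bound).
    assert (HTy : Rabs (T y) <= rem r * (8 * B)).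
    { unfold T. rewrite Rabs_mult. destruct (Hrem y Hy) as [R1 R2].
      rewrite (Rabs_pos_eq (rem y)) by exact R1.
      apply Rmult_le_compat; [exact R1 | apply Rabs_pos | exact R2 |].
      apply Rle_trans with (1 := Rabs_triang _ _). rewrite !Rabs_mult.
      set (X := Rabs (_ - _)). set (Y := Rabs (_ + _)).
      assert (HX : 0 <= X <= 4).
      { split; [apply Rabs_pos |]. unfold X.
        match goal with |- Rabs (?a * ?c - ?b * ?d) <= _ =>
          replace (a * c - b * d) with (a * c + b * - d) by ring end.
        apply Htrig; rewrite ?Rabs_Ropp; assumption. }
      assert (HY : 0 <= Y <= 4).
      { split; [apply Rabs_pos |]. now apply Htrig. }
      assert (0 <= Rabs (taylor_re s th N y)) by apply Rabs_pos.
      assert (0 <= Rabs (taylor_im s th N y)) by apply Rabs_pos.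
      nra. }
    unfold D'. rewrite !Rabs_mult, Rabs_left by lra.
    rewrite (Rabs_pos_eq (Rpower _ _)) by (left; apply exp_pos).
    replace (16 * P * B * rem r) with (- -2 * (P * (rem r * (8 * B)))) by ring.
    apply Rmult_le_compat_l; [lra |].
    apply Rmult_le_compat; [left; apply exp_pos | apply Rabs_pos | exact Hw | exact HTy]. }
  assert (HD0 : D 0 = 1).
  { unfold D, dist1_sqr. rewrite !Rmult_0_l, Rminus_0_r.
    replace (1 ^ 2 + 0 ^ 2) with 1 by ring. rewrite Rpower_one.
    replace (taylor_re s th N 0) with 1; [replace (taylor_im s th N 0) with 0 |].
    - ring.
    - clear. unfold taylor_im. induction N as [|N IH]; simpl.
      + rewrite (Rmult_0_l th), sin_0. ring.
      + rewrite <- IH. ring.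
    - clear. unfold taylor_re. induction N as [|N IH]; simpl.
      + rewrite (Rmult_0_l th), cos_0. ring.
      + rewrite <- IH. ring. }
  destruct (Hrem r ltac:(lra)) as [Rr _].
  assert (HDr : 1 - 16 * P * B * rem r <= D r).
  { destruct (Req_dec r 0) as [E | Hr0].
    - replace (D r) with 1 by (rewrite <- HD0; f_equal; lra).
      assert (0 <= 16 * P * B * rem r) by (apply Rmult_le_pos; lra). lra.
    - destruct (MVT_cor2 D D' 0 r) as [c [Hc1 Hc2]]; [lra | |].
      + intros c Hc'. apply is_derive_Reals. now apply HD.
      + assert (H := HT c ltac:(lra)). apply Rabs_le_between in H. rewrite HD0 in Hc1.
        assert (0 <= 16 * P * B * rem r) by (apply Rmult_le_pos; lra). nra. }
  assert (Hp := Hpos r ltac:(lra)).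
  assert (Hq : Rpower (dist1_sqr r th) (- s) * Rpower (dist1_sqr r th) s = 1).
  { rewrite <- Rpower_plus, Rplus_opp_l. apply Rpower_O. lra. }
  set (X := Rpower (dist1_sqr r th) (- s)) in *.
  assert (HX : 0 < X <= L).
  { split; [apply exp_pos |]. unfold X, L. rewrite !Rpower_Ropp.
    apply Rinv_le_contravar; [apply exp_pos |]. apply Rle_Rpower_l; lra. }
  assert (HXD : X * D r = taylor_re s th N r ^ 2 + taylor_im s th N r ^ 2).
  { unfold D. rewrite <- Rmult_assoc, Hq. ring. }
  assert (H0 : 0 <= 16 * P * B * rem r) by (apply Rmult_le_pos; lra).
  rewrite <- HXD. nra.
Qed.

Lemma dist1_sqr_continuous_Rpower (s r phi : R) (t : R) : 0 <= r < 1 ->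
  continuous (fun t => Rpower (dist1_sqr r (phi - t)) s) t.
Proof.
  intros Hr.
  apply (ex_derive_continuous (fun t => Rpower (dist1_sqr r (phi - t)) s)).
  eexists. apply (is_derive_Rpower_comp (fun t => dist1_sqr r (phi - t))).
  - unfold dist1_sqr. auto_derive; [trivial | reflexivity].
  - apply Rlt_le_trans with (2 := proj1 (dist1_sqr_bounds r (phi - t) Hr)). apply pow_lt; lra.
Qed.

(** For each [N] the pointwise comparison, Parseval and the coefficient bound apply. Since [K]
    depends neither on the angle nor on [N], the error integrates to a multiple of the remainder and
    disappears as [N] grows. *)
Lemma RInt_dist1_Rpower_le (s r phi : R) : 1 / 2 < s -> 0 <= r < 1 ->
  RInt (fun t => Rpower (dist1_sqr r (phi - t)) (- s)) 0 (2 * PI)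
  <= 2 * PI * (Gamma (2 * s - 1) / Gamma s ^ 2 * Rpower (1 - r ^ 2) (- (2 * s - 1))).
Proof.
  intros Hs Hr. assert (Hpi := PI_RGT_0).
  destruct (dist1_Rpower_le_taylor s r ltac:(lra) Hr) as [K [HK HKt]].
  set (J := Gamma (2 * s - 1) / Gamma s ^ 2).
  assert (HJ : 0 < J).
  { apply Rdiv_lt_0_compat; [apply Gamma_pos; lra |]. apply pow_lt, Gamma_pos. lra. }
  set (rem := fun N => (s + INR N) * binom_coef s N * r ^ N).
  assert (Hlim : is_lim_seq (fun N => 2 * PI * (J * Rpower (1 - r ^ 2) (- (2 * s - 1))) + 2 * PI * K * rem N)
    (2 * PI * (J * Rpower (1 - r ^ 2) (- (2 * s - 1))) + 2 * PI * K * 0)).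
  { apply is_lim_seq_plus'; [apply is_lim_seq_const |].
    apply (is_lim_seq_scal_l _ _ 0). apply taylor_remainder_to_0; lra. }
  rewrite Rmult_0_r, Rplus_0_r in Hlim.
  refine (is_lim_seq_le (fun _ => _) _ _ _ _ (is_lim_seq_const _) Hlim).
  intros N.
  assert (I := is_RInt_plus _ _ _ _ _ _ (is_RInt_taylor_sqr s phi r N)
    (is_RInt_const (V := R_NormedModule) 0 (2 * PI) (K * rem N))).
  unfold plus, scal in I; cbn -[pow binom_coef INR sum_f_R0] in I.
  unfold mult in I; cbn -[pow binom_coef INR sum_f_R0] in I.
  apply Rle_trans with (2 * PI * sum_f_R0 (fun n => (binom_coef s n * r ^ n) ^ 2) N
    + (2 * PI - 0) * (K * rem N)).
  - rewrite <- (is_RInt_unique _ _ _ _ I). apply RInt_le; [lra | | eexists; exact I |].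
    + apply (ex_RInt_continuous (fun t => Rpower (dist1_sqr r (phi - t)) (- s))).
      intros t _. now apply dist1_sqr_continuous_Rpower.
    + intros t _. apply HKt.
  - assert (Hsum : sum_f_R0 (fun n => (binom_coef s n * r ^ n) ^ 2) N
      <= J * Rpower (1 - r ^ 2) (- (2 * s - 1))).
    { apply Rle_trans with (J * sum_f_R0 (fun n => binom_coef (2 * s - 1) n * (r ^ 2) ^ n) N).
      - rewrite scal_sum. apply sum_Rle. intros n _.
        rewrite Rpow_mult_distr, <- !pow_mult, (Nat.mul_comm n 2).
        replace (binom_coef (2 * s - 1) n * r ^ (2 * n) * J)
          with (J * binom_coef (2 * s - 1) n * r ^ (2 * n)) by ring.
        apply Rmult_le_compat_r; [rewrite pow_mult; apply pow_le, pow2_ge_0 |].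
        now apply binom_coef_sqr_le.
      - apply Rmult_le_compat_l; [lra |]. apply sum_binom_coef_le; [lra | nra]. }
    nra.
Qed.

(** * The kernel as an exponential *)

Lemma cis_plus (a b : R) : cis (a + b) = (cis a * cis b)%C.
Proof.
  unfold cis, Cmult; simpl. rewrite cos_plus, sin_plus. f_equal; ring.
Qed.

Lemma cis_0 : cis 0 = RtoC 1.
Proof. unfold cis. now rewrite cos_0, sin_0. Qed.

Lemma Cmod_cis (t : R) : Cmod (cis t) = 1.
Proof.
  unfold Cmod, cis; simpl. replace (_ + _) with 1; [apply sqrt_1 |].
  assert (H := sin2_cos2 t). unfold Rsqr in H. lra.
Qed.

Lemma Cmod_sqr (z : C) : Cmod z ^ 2 = Re z ^ 2 + Im z ^ 2.
Proof.
  unfold Cmod. rewrite pow2_sqrt; [reflexivity |].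
  apply Rplus_le_le_0_compat; apply pow2_ge_0.
Qed.

Lemma pow2_le_inv (x y : R) : 0 <= y -> x ^ 2 <= y ^ 2 -> x <= y.
Proof. intros Hy H. apply Rsqr_incr_0_var; [unfold Rsqr; lra | exact Hy]. Qed.

Lemma Cmod_le_of_sqr (z : C) (B : R) : 0 <= B -> Re z ^ 2 + Im z ^ 2 <= B ^ 2 -> Cmod z <= B.
Proof.
  intros HB H. apply pow2_le_inv; [exact HB |]. now rewrite Cmod_sqr.
Qed.

Lemma Cmod_polar_right (w : C) : 0 < Re w ->
  Cmod w * cos (atan (Im w / Re w)) = Re w /\ Cmod w * sin (atan (Im w / Re w)) = Im w.
Proof.
  intros Hw. destruct w as [a b]; simpl in *.
  assert (Hm : Cmod (a, b) = a * sqrt (1 + (b / a)²)).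
  { unfold Cmod; simpl fst; simpl snd.
    replace (a ^ 2 + b ^ 2) with (a² * (1 + (b / a)²)) by (unfold Rsqr; field; lra).
    rewrite sqrt_mult_alt by apply Rle_0_sqr. rewrite sqrt_Rsqr by lra. reflexivity. }
  assert (0 < sqrt (1 + (b / a)²)).
  { apply sqrt_lt_R0. assert (H := Rle_0_sqr (b / a)). lra. }
  rewrite Hm, cos_atan, sin_atan. split; field; lra.
Qed.

(** In the disk, 1 - conj z has positive real part, so this half-plane is the only case needed;
    there the two-branch [acos] formula becomes a differentiable one. *)
Lemma Arg_right (w : C) : 0 < Re w -> Arg w = atan (Im w / Re w).
Proof.
  intros Hw. destruct (Cmod_polar_right w Hw) as [H1 H2].
  assert (Hm : 0 < Cmod w).
  { apply Cmod_gt_0. intros E. rewrite E in Hw. simpl in Hw. lra. }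
  assert (Hc : Re w / Cmod w = cos (atan (Im w / Re w))).
  { rewrite <- H1 at 1. field. lra. }
  assert (B := atan_bound (Im w / Re w)). assert (Hpi := PI_RGT_0).
  assert (M : forall x y, x < y -> atan x < atan y) by apply atan_increasing.
  unfold Arg. rewrite Hc. destruct (Rle_dec 0 (Im w)) as [Hi | Hi].
  - apply acos_cos. split; [| lra].
    assert (Hq : 0 <= Im w / Re w) by (apply Rdiv_le_0_compat; lra).
    destruct Hq as [Hq | Hq]; [apply M in Hq; rewrite atan_0 in Hq; lra |].
    rewrite <- Hq, atan_0. lra.
  - assert (Hq : Im w / Re w < 0).
    { apply Rmult_lt_reg_r with (Re w); [exact Hw |]. unfold Rdiv.
      rewrite Rmult_assoc, Rinv_l; lra. }
    apply M in Hq. rewrite atan_0 in Hq.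
    rewrite <- cos_neg, acos_cos by lra. ring.
Qed.

(* [P_alpha = exp (log_modulus + i alpha phase)] at [a + i b]. *)
Definition log_modulus (alpha a b : R) : R :=
  (alpha + 1) * ln (1 - (a ^ 2 + b ^ 2)) - (alpha + 2) / 2 * ln ((1 - a) ^ 2 + b ^ 2).
Definition phase (a b : R) : R := atan (- b / (1 - a)).

Lemma unit_disk_re_lt_1 (a b : R) : a ^ 2 + b ^ 2 < 1 -> 0 < 1 - a.
Proof. intros H. assert (0 <= b ^ 2) by apply pow2_ge_0. nra. Qed.

(** Let chi be the argument of 1 - conj z. The factors of the denominator have arguments -chi and
    (alpha + 1) chi, in total alpha chi, and their moduli multiply to |1-z|^(alpha+2). Thus [phase]
    = -chi is the argument of 1 - z. *)
Lemma P_kernel_exp (alpha a b : R) : a ^ 2 + b ^ 2 < 1 ->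
  P_kernel alpha (a, b) = (RtoC (exp (log_modulus alpha a b)) * cis (alpha * phase a b))%C.
Proof.
  intros Hab. assert (Ha := unit_disk_re_lt_1 a b Hab).
  assert (HD : 0 < (1 - a) ^ 2 + b ^ 2) by (assert (0 <= b ^ 2) by apply pow2_ge_0; nra).
  set (w := (1 - a, b) : C).
  assert (Hw : 0 < Re w) by exact Ha.
  assert (Hm : 0 < Cmod w).
  { apply Cmod_gt_0. intros E. rewrite E in Hw. simpl in Hw. lra. }
  set (chi := atan (b / (1 - a))).
  assert (Hphase : phase a b = - chi).
  { unfold phase, chi. rewrite <- atan_opp. f_equal. field. lra. }
  destruct (Cmod_polar_right w Hw) as [P1 P2]. simpl in P1, P2. fold chi in P1, P2.
  unfold P_kernel.
  replace (RtoC 1 - Cconj (a, b))%C with w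
    by (unfold w, Cminus, Cplus, Copp, Cconj; simpl; f_equal; ring).
  replace (RtoC 1 - (a, b))%C with (RtoC (Cmod w) * cis (- chi))%C.
  2:{ unfold cis, Cmult, Cminus, Cplus, Copp; simpl. rewrite cos_neg, sin_neg.
      f_equal; lra. }
  unfold Defs.Cpow. rewrite Arg_right by exact Hw. simpl Im. simpl Re. fold chi.
  replace (RtoC (Cmod w) * cis (- chi) * (RtoC (Rpower (Cmod w) (alpha + 1)) * cis ((alpha + 1) * chi)))%C
    with (RtoC (Rpower (Cmod w) (alpha + 2)) * cis (alpha * chi))%C.
  2:{ replace (alpha * chi) with (- chi + (alpha + 1) * chi) by ring. rewrite cis_plus.
      replace (alpha + 2) with (1 + (alpha + 1)) by ring.
      rewrite Rpower_plus, Rpower_1 by exact Hm. rewrite RtoC_mult. ring. }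
  rewrite Hphase.
  assert (Hpos : Rpower (Cmod w) (alpha + 2) <> 0) by (apply Rgt_not_eq, exp_pos).
  assert (Hc : (cis (alpha * chi) * cis (alpha * - chi))%C = RtoC 1).
  { rewrite <- cis_plus, <- cis_0. f_equal. ring. }
  assert (Hcn : cis (alpha * chi) <> RtoC 0).
  { intros E. rewrite E in Hc. apply (f_equal fst) in Hc. simpl in Hc. lra. }
  assert (Hmod : Rpower (1 - Cmod (a, b) ^ 2) (alpha + 1)
    = exp (log_modulus alpha a b) * Rpower (Cmod w) (alpha + 2)).
  { rewrite Cmod_sqr. simpl Re. simpl Im. unfold Rpower. rewrite <- exp_plus. f_equal.
    unfold log_modulus.
    replace (ln ((1 - a) ^ 2 + b ^ 2)) with (2 * ln (Cmod w)); [field |].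
    replace ((1 - a) ^ 2 + b ^ 2) with (Cmod w ^ 2) by (rewrite Cmod_sqr; reflexivity).
    simpl. rewrite Rmult_1_r, ln_mult by exact Hm. ring. }
  rewrite Hmod, RtoC_mult.
  apply (f_equal (fun c => (c / cis (alpha * chi))%C)) in Hc.
  replace (cis (alpha * - chi)) with (RtoC 1 / cis (alpha * chi))%C.
  - field. split; [exact Hcn |]. intros E. apply Hpos. now apply RtoC_inj.
  - rewrite <- Hc. field. exact Hcn.
Qed.

(** The pair on the left is the derivative of L along d = (p, q), that is L_z d + L_zbar conj(d).
    With e = (1-z)/(1 - conj z) and k = 1 - |z|^2 one finds k L_z = conj(e) - alpha conj(z) and k
    L_zbar = (alpha + 1) e, so the pole at z = 1 contributes only factors of modulus 1. *)
Lemma log_kernel_gradient (alpha a b p q : R) : -1 < alpha -> a ^ 2 + b ^ 2 < 1 ->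
  Cmod (- (2 * (alpha + 1) * (a * p + b * q)) / (1 - (a ^ 2 + b ^ 2))
          - (alpha + 2) * (- (1 - a) * p + b * q) / ((1 - a) ^ 2 + b ^ 2),
        alpha * (- (q * (1 - a) + b * p) / ((1 - a) ^ 2 + b ^ 2)))
  <= 2 * (alpha + 2) / (1 - (a ^ 2 + b ^ 2)) * Cmod (p, q).
Proof.
  intros Hal Hab. assert (Ha := unit_disk_re_lt_1 a b Hab).
  set (D := (1 - a) ^ 2 + b ^ 2). set (k := 1 - (a ^ 2 + b ^ 2)).
  assert (HD : 0 < D) by (unfold D; assert (0 <= b ^ 2) by apply pow2_ge_0; nra).
  assert (Hk : 0 < k) by (unfold k; lra).
  (* e = (1 - z) / (1 - conj z), of modulus 1 *)
  set (e := (((1 - a) ^ 2 - b ^ 2) / D, - 2 * (1 - a) * b / D) : C).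
  set (d := (p, q) : C). set (z := (a, b) : C).
  assert (He : Cmod e = 1).
  { unfold Cmod, e; simpl fst; simpl snd. replace (_ + _) with 1; [apply sqrt_1 |].
    unfold D in *. field. lra. }
  match goal with |- Cmod ?L <= _ =>
    replace L with (RtoC (/ k) * (d * (Cconj e - RtoC alpha * Cconj z)
      + RtoC (alpha + 1) * (e * Cconj d)))%C end.
  - rewrite Cmod_mult, Cmod_R, Rabs_pos_eq by (left; now apply Rinv_0_lt_compat).
    replace (2 * (alpha + 2) / k * Cmod d) with (/ k * (2 * (alpha + 2) * Cmod d)) by (field; lra).
    apply Rmult_le_compat_l; [left; now apply Rinv_0_lt_compat |].
    apply Rle_trans with (1 := Cmod_triangle _ _).
    rewrite !Cmod_mult, Cmod_conj, He, Cmod_R, (Rabs_pos_eq (alpha + 1)) by lra.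
    assert (H1 : Cmod (Cconj e - RtoC alpha * Cconj z) <= 1 + Rabs alpha).
    { unfold Cminus. apply Rle_trans with (1 := Cmod_triangle _ _).
      rewrite Cmod_opp, Cmod_mult, !Cmod_conj, Cmod_R, He.
      assert (Hz : Cmod z <= 1) by (apply Cmod_le_of_sqr; [lra | simpl Re; simpl Im; lra]).
      assert (0 <= Rabs alpha) by apply Rabs_pos. nra. }
    (* The case -alpha <= alpha + 2 is where alpha > -1 enters; with it 1 + |alpha| + (alpha + 1) <=
       2 (alpha + 2). *)
    assert (H2 : Rabs alpha <= alpha + 2) by (apply Rabs_le; lra).
    assert (0 <= Cmod d) by apply Cmod_ge_0. nra.
  - unfold d, e, z, Cmult, Cplus, Cminus, Copp, Cconj, RtoC; simpl fst; simpl snd.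
    unfold k, D in *. f_equal; field; lra.
Qed.

(** The mean value theorem fails for plane-valued functions, so it is applied to the scalar product
    with the total increment (X, Y). Cauchy-Schwarz then gives |(X, Y)|^2 <= |(X, Y)| times the
    bound, and one factor is divided out. *)
Lemma log_kernel_lipschitz (alpha a b p q kappa : R) : -1 < alpha -> 0 < kappa ->
  (forall tau, 0 <= tau <= 1 -> (a + tau * p) ^ 2 + (b + tau * q) ^ 2 <= 1 - kappa) ->
  Cmod (log_modulus alpha (a + p) (b + q) - log_modulus alpha a b,
        alpha * (phase (a + p) (b + q) - phase a b))
  <= 2 * (alpha + 2) / kappa * Cmod (p, q).
Proof.
  intros Hal Hkap Hseg.
  set (X := log_modulus alpha (a + p) (b + q) - log_modulus alpha a b).
  set (Y := alpha * (phase (a + p) (b + q) - phase a b)).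
  set (g := fun tau => X * log_modulus alpha (a + tau * p) (b + tau * q)
     + Y * (alpha * phase (a + tau * p) (b + tau * q))).
  set (L := fun tau => - (2 * (alpha + 1) * ((a + tau * p) * p + (b + tau * q) * q))
        / (1 - ((a + tau * p) ^ 2 + (b + tau * q) ^ 2))
     - (alpha + 2) * (- (1 - (a + tau * p)) * p + (b + tau * q) * q)
        / ((1 - (a + tau * p)) ^ 2 + (b + tau * q) ^ 2)).
  set (M := fun tau => alpha * (- (q * (1 - (a + tau * p)) + (b + tau * q) * p)
        / ((1 - (a + tau * p)) ^ 2 + (b + tau * q) ^ 2))).
  destruct (MVT_cor2 g (fun tau => X * L tau + Y * M tau) 0 1) as [c [Hc1 Hc2]]; [lra | |].
  { intros tau Ht. apply is_derive_Reals. specialize (Hseg tau Ht).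
    unfold g, log_modulus, phase, L, M.
    assert (H1 := unit_disk_re_lt_1 (a + tau * p) (b + tau * q) ltac:(lra)).
    assert (HD : 0 < (1 - (a + tau * p)) ^ 2 + (b + tau * q) ^ 2).
    { assert (0 <= (b + tau * q) ^ 2) by apply pow2_ge_0. nra. }
    auto_derive.
    - repeat split; try lra.
    - simpl in *. field. repeat split; try lra. }
  assert (Hg : g 1 - g 0 = X ^ 2 + Y ^ 2).
  { unfold g. rewrite !Rmult_1_l, !Rmult_0_l, !Rplus_0_r. unfold X, Y. ring. }
  rewrite Hg in Hc1.
  specialize (Hseg c ltac:(lra)).
  assert (HG := log_kernel_gradient alpha (a + c * p) (b + c * q) p q Hal ltac:(lra)).
  fold (L c) in HG. fold (M c) in HG.
  set (k := 1 - ((a + c * p) ^ 2 + (b + c * q) ^ 2)) in HG.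
  assert (Hk : kappa <= k) by (unfold k; lra).
  set (V := Cmod (X, Y)).
  assert (HV : V ^ 2 = X ^ 2 + Y ^ 2) by apply Cmod_sqr.
  assert (HV0 : 0 <= V) by apply Cmod_ge_0.
  assert (HCS : X * L c + Y * M c <= V * Cmod (L c, M c)).
  { assert (HW := Cmod_sqr (L c, M c)). assert (HW0 := Cmod_ge_0 (L c, M c)).
    simpl Re in HW. simpl Im in HW. set (W := Cmod (L c, M c)) in *.
    destruct (Rle_dec (X * L c + Y * M c) 0) as [H | H]; [assert (0 <= V * W) by nra; lra |].
    apply pow2_le_inv; [nra |].
    rewrite Rpow_mult_distr, HV, HW.
    assert (0 <= (X * M c - Y * L c) ^ 2) by apply pow2_ge_0. nra. }
  assert (HB : 2 * (alpha + 2) / k * Cmod (p, q) <= 2 * (alpha + 2) / kappa * Cmod (p, q)).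
  { apply Rmult_le_compat_r; [apply Cmod_ge_0 |].
    apply Rmult_le_compat_l; [lra |]. apply Rinv_le_contravar; lra. }
  set (B := 2 * (alpha + 2) / kappa * Cmod (p, q)) in *.
  assert (HVB : V * V <= V * B).
  { replace (V * V) with (V ^ 2) by ring. rewrite HV. nra. }
  destruct HV0 as [HV0 | HV0].
  - now apply Rmult_le_reg_l with V.
  - rewrite <- HV0. apply Rmult_le_pos; [| apply Cmod_ge_0].
    apply Rlt_le, Rdiv_lt_0_compat; lra.
Qed.

(** The squared left side is (e^x - 1)^2 + 2 e^x (1 - cos y); the two parts are controlled by x^2
    and y^2, up to the square of exp |(x, y)|. *)
Lemma Cexp_minus_1_le (x y : R) :
  Cmod (RtoC (exp x) * cis y - RtoC 1)%C <= Cmod (x, y) * exp (Cmod (x, y)).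
Proof.
  set (V := Cmod (x, y)). assert (HV0 : 0 <= V) by apply Cmod_ge_0.
  assert (HV : V ^ 2 = x ^ 2 + y ^ 2) by apply Cmod_sqr.
  assert (HxV : Rabs x <= V) by (apply Rle_trans with (2 := Rmax_Cmod (x, y)); apply Rmax_l).
  apply Rabs_le_between in HxV.
  set (F := exp V). assert (HF : 1 <= F).
  { unfold F. assert (H := exp_ineq1_le V). lra. }
  assert (HeF : exp x <= F).
  { unfold F. destruct (proj2 HxV) as [H | H]; [left; now apply exp_increasing | right; now f_equal]. }
  assert (Hex : 0 < exp x) by apply exp_pos.
  assert (He1 : (exp x - 1) ^ 2 <= x ^ 2 * F ^ 2).
  { rewrite <- Rpow_mult_distr. rewrite <- (pow2_abs (exp x - 1)), <- (pow2_abs (x * F)).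
    apply pow_incr. split; [apply Rabs_pos |].
    assert (H1 := exp_ineq1_le x). assert (H2 := exp_ineq1_le (- x)).
    rewrite exp_Ropp in H2.
    assert (H3 : exp x - 1 <= x * exp x).
    { apply Rmult_le_compat_l with (r := exp x) in H2; [| lra].
      rewrite Rinv_r in H2 by lra. nra. }
    rewrite Rabs_mult, (Rabs_pos_eq F) by lra.
    unfold Rabs. destruct (Rcase_abs (exp x - 1)); destruct (Rcase_abs x); nra. }
  assert (Hcos : 2 * (1 - cos y) <= y ^ 2).
  { assert (E : 1 - cos y = 2 * sin (y / 2) ^ 2).
    { replace y with (2 * (y / 2)) at 1 by field. rewrite cos_2a_sin. ring. }
    assert (Hs : Rabs (sin (y / 2)) <= Rabs (y / 2)).
    { destruct (Rtotal_order (y / 2) 0) as [H | [H | H]].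
      - rewrite <- (Rabs_Ropp (sin _)), <- (Rabs_Ropp (y / 2)), <- sin_neg.
        assert (Hy : 0 < - (y / 2)) by lra. set (h := - (y / 2)) in *.
        assert (sin h < h) by now apply sin_lt_x.
        rewrite (Rabs_pos_eq h) by lra. apply Rabs_le. split; [| lra].
        destruct (Rle_dec h 1).
        + assert (0 < sin h) by (apply sin_gt_0; [lra | assert (H' := PI2_1); lra]). lra.
        + assert (H' := SIN_bound h). lra.
      - rewrite H, sin_0. lra.
      - set (h := y / 2) in *.
        assert (sin h < h) by now apply sin_lt_x.
        rewrite (Rabs_pos_eq h) by lra. apply Rabs_le. split; [| lra].
        destruct (Rle_dec h 1).
        + assert (0 < sin h) by (apply sin_gt_0; [lra | assert (H' := PI2_1); lra]). lra.
        + assert (H' := SIN_bound h). lra. }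
    assert (H : sin (y / 2) ^ 2 <= (y / 2) ^ 2).
    { rewrite <- (pow2_abs (sin _)), <- (pow2_abs (y / 2)). apply pow_incr.
      split; [apply Rabs_pos | exact Hs]. }
    rewrite E. nra. }
  apply Cmod_le_of_sqr; [nra |].
  unfold cis, RtoC, Cmult, Cminus, Cplus, Copp; simpl Re; simpl Im.
  rewrite Rpow_mult_distr, HV.
  assert (H := sin2_cos2 y). unfold Rsqr in H.
  match goal with |- ?l <= _ => replace l with ((exp x - 1) ^ 2 + exp x * (2 * (1 - cos y))) end.
  - assert (exp x * (2 * (1 - cos y)) <= F ^ 2 * y ^ 2).
    { apply Rmult_le_compat; [lra | assert (B := COS_bound y); lra | nra | exact Hcos]. }
    nra.
  - transitivity (exp x ^ 2 * (sin y * sin y + cos y * cos y) + 1 - 2 * exp x * cos y);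
      [rewrite H; ring | ring].
Qed.

Lemma mult_exp_le (x y : R) : 0 <= x <= y -> x * exp x <= y * exp y.
Proof.
  intros H. apply Rmult_le_compat; try lra; [left; apply exp_pos |].
  destruct (proj2 H) as [H' | H']; [left; now apply exp_increasing | right; now f_equal].
Qed.

(** The quotient of the two kernel values is the exponential of the increment of L. The factor
    |P(z)| is kept on the right so that integration over the circle needs only the mean of
    |P_alpha|, which carries the constant 1/c_alpha. *)
Lemma P_kernel_diff_le (alpha kappa : R) (z d : C) : -1 < alpha -> 0 < kappa ->
  (forall tau, 0 <= tau <= 1 -> Cmod (z + RtoC tau * d)%C ^ 2 <= 1 - kappa) ->
  Cmod (P_kernel alpha (z + d) - P_kernel alpha z)%C
  <= Cmod (P_kernel alpha z)
     * (2 * (alpha + 2) / kappa * Cmod d * exp (2 * (alpha + 2) / kappa * Cmod d)).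
Proof.
  intros Hal Hk Hseg. destruct z as [a b]. destruct d as [p q].
  assert (Hseg' : forall tau, 0 <= tau <= 1 ->
    (a + tau * p) ^ 2 + (b + tau * q) ^ 2 <= 1 - kappa).
  { intros tau Ht. specialize (Hseg tau Ht). rewrite Cmod_sqr in Hseg.
    unfold Cplus, Cmult, RtoC in Hseg; simpl Re in Hseg; simpl Im in Hseg.
    replace (a + (tau * p - 0 * q)) with (a + tau * p) in Hseg by ring.
    replace (b + (tau * q + 0 * p)) with (b + tau * q) in Hseg by ring. exact Hseg. }
  assert (H0 := Hseg' 0 ltac:(lra)). assert (H1 := Hseg' 1 ltac:(lra)).
  rewrite !Rmult_0_l, !Rplus_0_r in H0. rewrite !Rmult_1_l in H1.
  change ((a, b) + (p, q))%C with ((a + p, b + q) : C).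
  rewrite !P_kernel_exp by lra.
  assert (HL := log_kernel_lipschitz alpha a b p q kappa Hal Hk Hseg').
  set (X := log_modulus alpha (a + p) (b + q) - log_modulus alpha a b) in *.
  set (Y := alpha * (phase (a + p) (b + q) - phase a b)) in *.
  replace (log_modulus alpha (a + p) (b + q)) with (log_modulus alpha a b + X)
    by (unfold X; ring).
  replace (alpha * phase (a + p) (b + q)) with (alpha * phase a b + Y) by (unfold Y; ring).
  rewrite exp_plus, cis_plus, RtoC_mult.
  set (P := (RtoC (exp (log_modulus alpha a b)) * cis (alpha * phase a b))%C).
  replace (_ - P)%C with (P * (RtoC (exp X) * cis Y - RtoC 1))%C by (unfold P; ring).
  rewrite Cmod_mult. apply Rmult_le_compat_l; [apply Cmod_ge_0 |].
  apply Rle_trans with (1 := Cexp_minus_1_le X Y).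
  apply mult_exp_le. split; [apply Cmod_ge_0 | exact HL].
Qed.

(** The arctangent gives an angle in the right half-plane; any other nonzero point is first rotated
    there by pi or by a quarter turn. *)
Lemma polar_form (z : C) : exists phi, z = (RtoC (Cmod z) * cis phi)%C.
Proof.
  assert (H : forall z : C, 0 < Re z -> exists phi, z = (RtoC (Cmod z) * cis phi)%C).
  { intros w Hw. exists (atan (Im w / Re w)). destruct (Cmod_polar_right w Hw) as [H1 H2].
    unfold cis, RtoC, Cmult; simpl. destruct w as [a b]; simpl in *. f_equal; lra. }
  assert (R : forall u t, (exists phi, (z * cis t)%C = (RtoC u * cis phi)%C) ->
    exists phi, z = (RtoC u * cis phi)%C).
  { intros u t [phi E]. exists (phi + - t).
    rewrite cis_plus, Cmult_assoc, <- E, <- Cmult_assoc, <- cis_plus, Rplus_opp_r, cis_0. ring. }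
  assert (Hm : forall t, Cmod (z * cis t)%C = Cmod z) by (intros t; rewrite Cmod_mult, Cmod_cis; ring).
  destruct (Rtotal_order (Re z) 0) as [Hz | [Hz | Hz]].
  - apply (R _ PI). rewrite <- (Hm PI). apply H.
    unfold cis, Cmult; simpl. rewrite cos_PI, sin_PI. unfold Re in Hz. lra.
  - destruct (Rtotal_order (Im z) 0) as [Hi | [Hi | Hi]].
    + apply (R _ (PI / 2)). rewrite <- (Hm (PI / 2)). apply H.
      unfold cis, Cmult; simpl. rewrite cos_PI2, sin_PI2. unfold Re, Im in *. lra.
    + exists 0. destruct z as [a b]; simpl in *. subst.
      change ((0, 0) : C) with (RtoC 0). rewrite Cmod_0. ring.
    + apply (R _ (- (PI / 2))). rewrite <- (Hm (- (PI / 2))). apply H.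
      unfold cis, Cmult; simpl. rewrite cos_neg, sin_neg, cos_PI2, sin_PI2. unfold Re, Im in *. lra.
  - now apply H.
Qed.

Lemma Cmod_P_kernel (alpha r th : R) : 0 <= r < 1 ->
  Cmod (P_kernel alpha (RtoC r * cis th))
  = Rpower (1 - r ^ 2) (alpha + 1) * Rpower (dist1_sqr r th) (- (alpha / 2 + 1)).
Proof.
  intros Hr.
  assert (H := sin2_cos2 th). unfold Rsqr in H.
  assert (Hs : (r * cos th) ^ 2 + (r * sin th) ^ 2 = r ^ 2).
  { transitivity (r ^ 2 * (sin th * sin th + cos th * cos th)); [ring | rewrite H; ring]. }
  replace (RtoC r * cis th)%C with ((r * cos th, r * sin th) : C)
    by (unfold cis, RtoC, Cmult; simpl; f_equal; ring).
  rewrite P_kernel_exp by nra.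
  rewrite Cmod_mult, Cmod_R, Cmod_cis, Rmult_1_r, Rabs_pos_eq by (left; apply exp_pos).
  unfold Rpower. rewrite <- exp_plus. f_equal.
  unfold log_modulus. rewrite Hs. fold (dist1_sqr r th). field.
Qed.

Lemma c_const_pos (alpha : R) : -1 < alpha -> 0 < c_const alpha.
Proof.
  intros Hal. apply Rdiv_lt_0_compat; [apply pow_lt |]; apply Gamma_pos; lra.
Qed.

Lemma norm_C_R (z : C) : norm (K := R_AbsRing) (V := C_R_NormedModule) z = Cmod z.
Proof.
  unfold norm; simpl. unfold prod_norm, Cmod; simpl. f_equal.
  unfold norm; simpl. unfold abs; simpl. rewrite !Rmult_1_r.
  rewrite <- !Rabs_mult, !Rabs_pos_eq; [reflexivity | apply Rle_0_sqr ..].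
Qed.

Lemma ex_RInt_C (g : R -> C) (a b : R) :
  (forall t, continuous (fun t => Re (g t)) t) ->
  (forall t, continuous (fun t => Im (g t)) t) ->
  ex_RInt (V := C_R_NormedModule) g a b.
Proof.
  intros Hre Him.
  destruct (ex_RInt_continuous (fun t => Re (g t)) a b (fun t _ => Hre t)) as [u Hu].
  destruct (ex_RInt_continuous (fun t => Im (g t)) a b (fun t _ => Him t)) as [v Hv].
  exists (u, v). now apply (is_RInt_fct_extend_pair g a b u v).
Qed.

Lemma Cmod_CInt_le (g : R -> C) (h : R -> R) (a b : R) : a <= b ->
  ex_RInt (V := C_R_NormedModule) g a b -> ex_RInt h a b ->
  (forall t, a <= t <= b -> Cmod (g t) <= h t) ->
  Cmod (CInt g a b) <= RInt h a b.
Proof.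
  intros Hab Hg Hh Hle. rewrite <- norm_C_R.
  apply (norm_RInt_le (V := C_R_NormedModule) g h a b); [exact Hab | | |].
  - intros t Ht. rewrite norm_C_R. now apply Hle.
  - apply (RInt_correct (V := C_R_CompleteNormedModule) g a b Hg).
  - now apply (RInt_correct h).
Qed.

Lemma P_kernel_rot_continuous (alpha : R) (z : C) : unit_disk z ->
  (forall t, continuous (fun t => Re (P_kernel alpha (z * cis (- t)))) t) /\
  (forall t, continuous (fun t => Im (P_kernel alpha (z * cis (- t)))) t) /\
  (forall t, continuous (fun t => Cmod (P_kernel alpha (z * cis (- t)))) t).
Proof.
  intros Hz. unfold unit_disk in Hz. assert (Hz0 := Cmod_ge_0 z).
  destruct z as [x y].
  (* Real and imaginary parts of z e^(-it). *)
  set (a := fun t => x * cos t + y * sin t). set (b := fun t => y * cos t - x * sin t).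
  assert (Hab : forall t, a t ^ 2 + b t ^ 2 < 1).
  { intros t. assert (H := sin2_cos2 t). unfold Rsqr in H.
    replace (a t ^ 2 + b t ^ 2) with ((x ^ 2 + y ^ 2) * (sin t * sin t + cos t * cos t))
      by (unfold a, b; ring).
    rewrite H. assert (E := Cmod_sqr (x, y)). simpl Re in E. simpl Im in E. nra. }
  assert (E : forall t, P_kernel alpha ((x, y) * cis (- t))
    = (RtoC (exp (log_modulus alpha (a t) (b t))) * cis (alpha * phase (a t) (b t)))%C).
  { intros t. rewrite <- P_kernel_exp by apply Hab. f_equal.
    unfold cis, Cmult; simpl. rewrite cos_neg, sin_neg. unfold a, b. f_equal; ring. }
  assert (Cm : forall t, ex_derive (fun t => log_modulus alpha (a t) (b t)) t).
  { intros t. specialize (Hab t). assert (H1 := unit_disk_re_lt_1 _ _ Hab).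
    assert (H2 : 0 < (1 - a t) ^ 2 + b t ^ 2) by (assert (0 <= b t ^ 2) by apply pow2_ge_0; nra).
    unfold log_modulus. unfold a, b in *. auto_derive. repeat split; lra. }
  assert (Cp : forall t, ex_derive (fun t => phase (a t) (b t)) t).
  { intros t. specialize (Hab t). assert (H1 := unit_disk_re_lt_1 _ _ Hab).
    unfold phase. unfold a, b in *. auto_derive. repeat split; lra. }
  assert (Hm : forall m p : R -> R, (forall t, ex_derive m t) -> (forall t, ex_derive p t) ->
    forall t, continuous (fun t => exp (m t) * cos (alpha * p t)) t
      /\ continuous (fun t => exp (m t) * sin (alpha * p t)) t
      /\ continuous (fun t => exp (m t)) t).
  { intros m p Dm Dp t. split; [| split].
    - apply (ex_derive_continuous (fun t => exp (m t) * cos (alpha * p t))).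
      auto_derive. repeat split; auto.
    - apply (ex_derive_continuous (fun t => exp (m t) * sin (alpha * p t))).
      auto_derive. repeat split; auto.
    - apply (ex_derive_continuous (fun t => exp (m t))). auto_derive. repeat split; auto. }
  specialize (Hm _ _ Cm Cp).
  split; [| split]; intros t; destruct (Hm t) as [H1 [H2 H3]].
  - apply continuous_ext with (2 := H1). intros u. rewrite E.
    unfold cis, RtoC, Cmult; simpl. ring_R.
  - apply continuous_ext with (2 := H2). intros u. rewrite E.
    unfold cis, RtoC, Cmult; simpl. ring_R.
  - apply continuous_ext with (2 := H3). intros u. rewrite E.
    rewrite Cmod_mult, Cmod_R, Cmod_cis, Rmult_1_r, Rabs_pos_eq by (left; apply exp_pos).
    reflexivity.
Qed.

Lemma RInt_Cmod_P_kernel_le (alpha : R) (z : C) : -1 < alpha -> unit_disk z ->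
  RInt (fun t => Cmod (P_kernel alpha (z * cis (- t)))) 0 (2 * PI) <= 2 * PI / c_const alpha.
Proof.
  intros Hal Hz. unfold unit_disk in Hz. assert (Hz0 := Cmod_ge_0 z).
  destruct (polar_form z) as [phi E]. set (r := Cmod z) in *.
  rewrite (RInt_ext _ (fun t => Rpower (1 - r ^ 2) (alpha + 1)
    * Rpower (dist1_sqr r (phi - t)) (- (alpha / 2 + 1)))).
  2:{ intros t _. rewrite <- Cmod_P_kernel by lra. f_equal. f_equal.
      rewrite E. unfold Rminus. rewrite cis_plus. ring. }
  rewrite (RInt_scal (fun t => Rpower (dist1_sqr r (phi - t)) (- (alpha / 2 + 1)))).
  2:{ apply (ex_RInt_continuous (fun t => Rpower (dist1_sqr r (phi - t)) (- (alpha / 2 + 1)))).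
      intros t _. apply dist1_sqr_continuous_Rpower. lra. }
  unfold scal; simpl. unfold mult; simpl.
  assert (H := RInt_dist1_Rpower_le (alpha / 2 + 1) r phi ltac:(lra) ltac:(lra)).
  replace (2 * (alpha / 2 + 1) - 1) with (alpha + 1) in H by field.
  assert (HP : 0 < Rpower (1 - r ^ 2) (alpha + 1)) by apply exp_pos.
  apply Rmult_le_compat_l with (r := Rpower (1 - r ^ 2) (alpha + 1)) in H; [| lra].
  (* For s = alpha/2 + 1 one has 2 s - 1 = alpha + 1, so the powers of 1 - r^2 cancel and the Gamma
     quotient is the inverse of [c_const]. *)
  apply Rle_trans with (1 := H). rewrite Rpower_Ropp. unfold c_const.
  right. field. repeat split; try (apply Rgt_not_eq; apply Gamma_pos; lra). lra.
Qed.

(** * Boundary values and distributional limits *)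

Lemma continuous_Re (g : R -> C) (t : R) : continuous g t -> continuous (fun t => Re (g t)) t.
Proof. intros H. apply (continuous_comp g Re); [exact H | apply continuous_fst]. Qed.

Lemma continuous_Im (g : R -> C) (t : R) : continuous g t -> continuous (fun t => Im (g t)) t.
Proof. intros H. apply (continuous_comp g Im); [exact H | apply continuous_snd]. Qed.

Lemma continuous_cis (t : R) : continuous cis t.
Proof.
  apply filterlim_locally. intros eps.
  assert (Hc := proj1 (filterlim_locally _ _) (continuous_cos t) eps).
  assert (Hs := proj1 (filterlim_locally _ _) (continuous_sin t) eps).
  apply filter_imp with (2 := filter_and _ _ Hc Hs). intros s H. exact H.
Qed.

Lemma continuous_on_circle (g : C -> C) (t : R) :
  continuous_on unit_circle g -> continuous (fun t => g (cis t)) t.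
Proof.
  intros Hg. unfold continuous.
  apply (filterlim_comp _ _ _ cis g _ (within unit_circle (locally (cis t)))).
  - intros P HP. unfold within in HP. apply continuous_cis in HP.
    unfold filtermap in *. apply filter_imp with (2 := HP).
    intros s Hs. apply Hs. apply Cmod_cis.
  - apply Hg. apply Cmod_cis.
Qed.

(** Rotation by e^(-it) changes neither |d| nor the moduli along the segment, so the relative kernel
    estimate is uniform in t and comes out of the integral. [B] is left free because the lemma is
    used with [M] before the boundary bound is known and with 1 afterwards. *)
Lemma poisson_lipschitz (alpha kappa B : R) (f fstar : C -> C) (z d : C) :
  -1 < alpha -> 0 < kappa -> poisson_represented alpha f fstar ->
  continuous_on unit_circle fstar ->
  (forall t, 0 <= t <= 2 * PI -> Cmod (fstar (cis t)) <= B) ->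
  (forall tau, 0 <= tau <= 1 -> Cmod (z + RtoC tau * d)%C ^ 2 <= 1 - kappa) ->
  Cmod (f (z + d) - f z)%C
  <= B / c_const alpha
     * (2 * (alpha + 2) / kappa * Cmod d * exp (2 * (alpha + 2) / kappa * Cmod d)).
Proof.
  intros Hal Hk Hf Hc HB Hseg.
  assert (Hpi := PI_RGT_0).
  set (E := 2 * (alpha + 2) / kappa * Cmod d).
  assert (Hdisk : forall w : C, Cmod w ^ 2 <= 1 - kappa -> unit_disk w).
  { intros w Hw. unfold unit_disk. apply Rnot_le_lt. intros H.
    assert (1 ^ 2 <= Cmod w ^ 2) by (apply pow_incr; lra). lra. }
  assert (Hz : unit_disk z).
  { apply Hdisk. replace z with (z + RtoC 0 * d)%C by ring. apply Hseg. lra. }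
  assert (Hzd : unit_disk (z + d)%C).
  { apply Hdisk. replace (z + d)%C with (z + RtoC 1 * d)%C by ring. apply Hseg. lra. }
  assert (Hfre : forall t, continuous (fun t => Re (fstar (cis t))) t)
    by (intros t; apply continuous_Re; now apply continuous_on_circle).
  assert (Hfim : forall t, continuous (fun t => Im (fstar (cis t))) t)
    by (intros t; apply continuous_Im; now apply continuous_on_circle).
  assert (Hex : forall w, unit_disk w -> ex_RInt (V := C_R_NormedModule)
    (fun t => (P_kernel alpha (w * cis (- t)) * fstar (cis t))%C) 0 (2 * PI)).
  { intros w Hw. destruct (P_kernel_rot_continuous alpha w Hw) as [Pre [Pim _]].
    apply ex_RInt_C; intros t; unfold Cmult; simpl.
    - apply (continuous_minus (fun t => Re (P_kernel alpha (w * cis (- t))) * Re (fstar (cis t)))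
        (fun t => Im (P_kernel alpha (w * cis (- t))) * Im (fstar (cis t))));
      apply (continuous_mult (K := R_AbsRing)); auto.
    - apply (continuous_plus (fun t => Re (P_kernel alpha (w * cis (- t))) * Im (fstar (cis t)))
        (fun t => Im (P_kernel alpha (w * cis (- t))) * Re (fstar (cis t))));
      apply (continuous_mult (K := R_AbsRing)); auto. }
  rewrite (Hf _ Hzd), (Hf _ Hz).
  match goal with |- Cmod (?c * ?a - ?c * ?b) <= _ =>
    replace (c * a - c * b)%C with (c * (a - b))%C by ring end.
  rewrite Cmod_mult, Cmod_R, Rabs_pos_eq by (left; apply Rinv_0_lt_compat; lra).
  assert (HI : Cmod (CInt (fun t => (P_kernel alpha ((z + d) * cis (- t)) * fstar (cis t))%C) 0 (2 * PI)
    - CInt (fun t => (P_kernel alpha (z * cis (- t)) * fstar (cis t))%C) 0 (2 * PI))%C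
    <= RInt (fun t => B * (E * exp E) * Cmod (P_kernel alpha (z * cis (- t)))) 0 (2 * PI)).
  { change (Cmod (minus (G := C_R_CompleteNormedModule)
      (CInt (fun t => (P_kernel alpha ((z + d) * cis (- t)) * fstar (cis t))%C) 0 (2 * PI))
      (CInt (fun t => (P_kernel alpha (z * cis (- t)) * fstar (cis t))%C) 0 (2 * PI)))
      <= RInt (fun t => B * (E * exp E) * Cmod (P_kernel alpha (z * cis (- t)))) 0 (2 * PI)).
    unfold CInt. rewrite <- (RInt_minus (V := C_R_CompleteNormedModule)) by now apply Hex.
    apply Cmod_CInt_le; [lra | | |].
    - apply (ex_RInt_minus (V := C_R_NormedModule)); now apply Hex.
    - apply (ex_RInt_scal (fun t => Cmod (P_kernel alpha (z * cis (- t))))).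
      apply (ex_RInt_continuous (fun t => Cmod (P_kernel alpha (z * cis (- t))))).
      intros t _. now apply P_kernel_rot_continuous.
    - intros t Ht.
      change (Cmod (P_kernel alpha ((z + d) * cis (- t)) * fstar (cis t)
        - P_kernel alpha (z * cis (- t)) * fstar (cis t))%C
        <= B * (E * exp E) * Cmod (P_kernel alpha (z * cis (- t)))).
      replace (_ - _)%C with ((P_kernel alpha (z * cis (- t) + d * cis (- t))
        - P_kernel alpha (z * cis (- t))) * fstar (cis t))%C
        by (rewrite <- Cmult_plus_distr_r; ring).
      rewrite Cmod_mult.
      assert (HP := P_kernel_diff_le alpha kappa (z * cis (- t)) (d * cis (- t)) Hal Hk).
      rewrite (Cmod_mult d), Cmod_cis, Rmult_1_r in HP. fold E in HP.
      assert (HP' : Cmod (P_kernel alpha (z * cis (- t) + d * cis (- t)) - P_kernel alpha (z * cis (- t)))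
        <= Cmod (P_kernel alpha (z * cis (- t))) * (E * exp E)).
      { apply HP. intros tau Htau.
        replace (z * cis (- t) + RtoC tau * (d * cis (- t)))%C
          with ((z + RtoC tau * d) * cis (- t))%C by ring.
        rewrite Cmod_mult, Cmod_cis, Rmult_1_r. now apply Hseg. }
      replace (B * (E * exp E) * Cmod (P_kernel alpha (z * cis (- t))))
        with (Cmod (P_kernel alpha (z * cis (- t))) * (E * exp E) * B) by ring.
      apply Rmult_le_compat; try apply Cmod_ge_0; [exact HP' | now apply HB]. }
  rewrite (RInt_scal (fun t => Cmod (P_kernel alpha (z * cis (- t))))) in HI.
  2:{ apply (ex_RInt_continuous (fun t => Cmod (P_kernel alpha (z * cis (- t))))).
      intros t _. now apply P_kernel_rot_continuous. }
  unfold scal in HI; simpl in HI. unfold mult in HI; simpl in HI.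
  assert (HB0 : 0 <= B) by (apply Rle_trans with (2 := HB 0 ltac:(lra)); apply Cmod_ge_0).
  assert (HE0 : 0 <= E).
  { unfold E. apply Rmult_le_pos; [apply Rlt_le, Rdiv_lt_0_compat; lra | apply Cmod_ge_0]. }
  assert (HBE : 0 <= B * (E * exp E)).
  { apply Rmult_le_pos; [exact HB0 |]. apply Rmult_le_pos; [exact HE0 | left; apply exp_pos]. }
  assert (HP := RInt_Cmod_P_kernel_le alpha z Hal Hz).
  assert (Hcc := c_const_pos alpha Hal).
  apply Rle_trans with (/ (2 * PI) * (B * (E * exp E) * (2 * PI / c_const alpha))).
  - apply Rmult_le_compat_l; [left; apply Rinv_0_lt_compat; lra |].
    apply Rle_trans with (1 := HI). now apply Rmult_le_compat_l.
  - right. field. lra.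
Qed.

Lemma Cmod_segment_le (z d : C) (r tau : R) : 0 <= tau <= 1 ->
  Cmod z <= r -> Cmod (z + d) <= r -> Cmod (z + RtoC tau * d) <= r.
Proof.
  intros Ht Hz Hw.
  replace (z + RtoC tau * d)%C with (RtoC (1 - tau) * z + RtoC tau * (z + d))%C
    by (rewrite RtoC_minus; ring).
  apply Rle_trans with (1 := Cmod_triangle _ _).
  rewrite !Cmod_mult, !Cmod_R, !Rabs_pos_eq by lra. nra.
Qed.

(** [CInt] is a total function, so its value carries information only for an integrable integrand;
    continuity on inner circles secures this for the pairings of f_r. *)
Lemma poisson_continuous_circle (alpha B r : R) (f fstar : C -> C) :
  -1 < alpha -> poisson_represented alpha f fstar ->
  continuous_on unit_circle fstar ->
  (forall t, 0 <= t <= 2 * PI -> Cmod (fstar (cis t)) <= B) ->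
  0 <= r < 1 -> forall t, continuous (fun t => f (RtoC r * cis t)%C) t.
Proof.
  intros Hal Hf Hc HB Hr t.
  set (C0 := 2 * (alpha + 2) / (1 - r ^ 2)).
  set (E := fun s => C0 * Cmod (RtoC r * cis s - RtoC r * cis t)%C).
  assert (HE : forall s, Cmod (f (RtoC r * cis s) - f (RtoC r * cis t))%C
    <= B / c_const alpha * (E s * exp (E s))).
  { intros s.
    replace (RtoC r * cis s)%C with (RtoC r * cis t + (RtoC r * cis s - RtoC r * cis t))%C at 1 by ring.
    apply (poisson_lipschitz alpha (1 - r ^ 2) B f fstar); try assumption; [nra |].
    assert (Hm : forall u, Cmod (RtoC r * cis u) <= r).
    { intros u. rewrite Cmod_mult, Cmod_cis, Cmod_R, Rabs_pos_eq; lra. }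
    intros tau Htau. replace (1 - (1 - r ^ 2)) with (r ^ 2) by ring.
    apply pow_incr. split; [apply Cmod_ge_0 |]. apply Cmod_segment_le; [exact Htau | apply Hm |].
    replace (RtoC r * cis t + (RtoC r * cis s - RtoC r * cis t))%C with (RtoC r * cis s)%C by ring.
    apply Hm. }
  assert (HEc : continuous (fun s => B / c_const alpha * (E s * exp (E s))) t).
  { apply (continuous_comp E (fun e => B / c_const alpha * (e * exp e))).
    - unfold E. apply (continuous_scal_r C0 (fun s => Cmod (RtoC r * cis s - RtoC r * cis t))).
      apply continuous_ext with (fun s => sqrt ((r * cos s - r * cos t) ^ 2 + (r * sin s - r * sin t) ^ 2)).
      + intros s. unfold Cmod, cis, RtoC, Cmult, Cminus, Cplus, Copp; simpl. f_equal. ring_R.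
      + apply (continuous_comp (fun s => (r * cos s - r * cos t) ^ 2 + (r * sin s - r * sin t) ^ 2) sqrt).
        * apply (ex_derive_continuous (fun s => (r * cos s - r * cos t) ^ 2 + (r * sin s - r * sin t) ^ 2)).
          auto_derive. trivial.
        * apply continuous_sqrt.
    - apply (ex_derive_continuous (fun e => B / c_const alpha * (e * exp e))). auto_derive. trivial. }
  apply filterlim_locally. intros eps.
  assert (H := proj1 (filterlim_locally _ _) HEc eps).
  apply filter_imp with (2 := H). intros s Hs.
  assert (HE0 : E t = 0).
  { unfold E. replace (RtoC r * cis t - RtoC r * cis t)%C with (RtoC 0) by ring.
    rewrite Cmod_0. ring. }
  rewrite HE0 in Hs.
  change (Rabs (B / c_const alpha * (E s * exp (E s)) - B / c_const alpha * (0 * exp 0)) < eps) in Hs.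
  rewrite Rmult_0_l, Rmult_0_r, Rminus_0_r in Hs. apply Rabs_def2 in Hs.
  assert (HM := Rmax_Cmod (f (RtoC r * cis s) - f (RtoC r * cis t))%C).
  specialize (HE s). split.
  - change (Rabs (Re (f (RtoC r * cis s) - f (RtoC r * cis t))%C) < eps).
    apply Rle_lt_trans with (2 := proj1 Hs). apply Rle_trans with (2 := HE).
    apply Rle_trans with (2 := HM). apply Rmax_l.
  - change (Rabs (Im (f (RtoC r * cis s) - f (RtoC r * cis t))%C) < eps).
    apply Rle_lt_trans with (2 := proj1 Hs). apply Rle_trans with (2 := HE).
    apply Rle_trans with (2 := HM). apply Rmax_r.
Qed.

(** * Trigonometric test functions and the bound |f*| <= 1 *)

Inductive trig_poly : (R -> R) -> Prop :=
  | trig_const (c : R) : trig_poly (fun _ => c)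
  | trig_cos : trig_poly cos
  | trig_sin : trig_poly sin
  | trig_plus (f g : R -> R) : trig_poly f -> trig_poly g -> trig_poly (fun t => f t + g t)
  | trig_mult (f g : R -> R) : trig_poly f -> trig_poly g -> trig_poly (fun t => f t * g t).

Lemma trig_poly_derive (f : R -> R) : trig_poly f ->
  exists g, trig_poly g /\ forall t, is_derive f t (g t).
Proof.
  induction 1 as [c | | | f g Hf [f' [Tf Df]] Hg [g' [Tg Dg]] | f g Hf [f' [Tf Df]] Hg [g' [Tg Dg]]].
  - exists (fun _ => 0). split; [constructor | intros t; apply (is_derive_const c)].
  - exists (fun t => -1 * sin t). split; [repeat constructor |].
    intros t. replace (-1 * sin t) with (- sin t) by ring. apply is_derive_cos.
  - exists cos. split; [constructor | apply is_derive_sin].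
  - exists (fun t => f' t + g' t). split; [now constructor |].
    intros t. now apply (is_derive_plus f g).
  - exists (fun t => f' t * g t + f t * g' t). split; [now repeat constructor |].
    intros t. apply (is_derive_mult f g); [apply Df | apply Dg | intros; apply Rmult_comm].
Qed.

(** Equality is only pointwise because membership in [trig_poly] depends on how a function is
    written. Closure under differentiation gives smoothness without computing any higher derivative
    of a power of [bump]. *)
Lemma trig_poly_Derive_n (f : R -> R) (n : nat) : trig_poly f ->
  exists g, trig_poly g /\ forall t, Derive_n f n t = g t.
Proof.
  intros Hf. induction n as [|n [g [Tg Hg]]]; [now exists f |].
  destruct (trig_poly_derive g Tg) as [g' [Tg' Dg]].
  exists g'. split; [exact Tg' |]. intros t. simpl.
  rewrite (Derive_ext _ _ _ Hg). apply is_derive_unique, Dg.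
Qed.

Lemma trig_poly_ex_derive_n (f : R -> R) (n : nat) (t : R) : trig_poly f -> ex_derive_n f n t.
Proof.
  intros Hf. destruct n as [|n]; [exact I |]. simpl.
  destruct (trig_poly_Derive_n f n Hf) as [g [Tg Hg]].
  destruct (trig_poly_derive g Tg) as [g' [_ Dg]].
  apply ex_derive_ext with g; [intros s; symmetry; apply Hg |]. eexists. apply Dg.
Qed.

Lemma trig_poly_pow (f : R -> R) (n : nat) : trig_poly f -> trig_poly (fun t => f t ^ n).
Proof. intros Hf. induction n as [|n IH]; simpl; now constructor. Qed.

Lemma trig_poly_continuous (f : R -> R) (t : R) : trig_poly f -> continuous f t.
Proof.
  intros Hf. apply (ex_derive_continuous f).
  destruct (trig_poly_derive f Hf) as [g [_ Dg]]. eexists. apply Dg.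
Qed.

(* [cos^2 (s/2)] for [s = t - t0], written without a shift of the variable. *)
Definition bump (t0 t : R) : R := / 2 + / 2 * (cos t0 * cos t + sin t0 * sin t).

Lemma bump_eq (t0 t : R) : bump t0 t = (1 + cos (t - t0)) / 2.
Proof. unfold bump. rewrite cos_minus. field. Qed.

Lemma bump_trig_poly (t0 : R) (n : nat) : trig_poly (fun t => bump t0 t ^ n).
Proof. apply trig_poly_pow. unfold bump. repeat constructor. Qed.

Lemma RInt_ge_const (f : R -> R) (a b m : R) : a <= b -> ex_RInt f a b ->
  (forall t, a < t < b -> m <= f t) -> m * (b - a) <= RInt f a b.
Proof.
  intros Hab Hf Hm.
  replace (m * (b - a)) with (RInt (fun _ => m) a b).
  - apply RInt_le; [exact Hab | apply ex_RInt_const | exact Hf | exact Hm].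
  - rewrite RInt_const. unfold scal; simpl. unfold mult; simpl. ring.
Qed.

(** Concentration of powers: within eta/2 of [t0] the integrand is at least D q1^n, from there to
    distance eta it is nonnegative, and farther away it is at least -B q2^n. As q2 < q1, the centre
    wins for large n. *)
Lemma RInt_bump_pos (k : R -> R) (t0 : R) :
  (forall t, continuous k t) -> 0 < t0 < 2 * PI -> 0 < k t0 ->
  exists n, 0 < RInt (fun t => k t * bump t0 t ^ n) 0 (2 * PI).
Proof.
  intros Hk Ht0 Hk0. assert (Hpi := PI_RGT_0). assert (HPI2 := PI2_1).
  assert (Heps : 0 < k t0 / 2) by lra.
  destruct (proj1 (filterlim_locally _ _) (Hk t0) (mkposreal _ Heps)) as [[eta0 Heta0] Hnear].
  assert (Hnear' : forall t, Rabs (t - t0) < eta0 -> k t0 / 2 <= k t).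
  { intros t Ht. assert (H := Hnear t Ht).
    change (Rabs (k t - k t0) < k t0 / 2) in H. apply Rabs_def2 in H. lra. }
  clear Hnear Heps.
  (* [eta < eta0] keeps k above half its value at [t0]. The conditions at 0 and 2 pi keep the window
     inside the period and give |t - t0| <= 2 pi - eta on all of it; [eta <= 1] stays where the
     cosine decreases. *)
  assert (Heta : exists eta, 0 < eta < eta0 /\ eta <= t0 /\ t0 + eta <= 2 * PI /\ eta <= 1).
  { exists (Rmin (eta0 / 2) (Rmin 1 (Rmin t0 (2 * PI - t0)))).
    assert (L1 := Rmin_l (eta0 / 2) (Rmin 1 (Rmin t0 (2 * PI - t0)))).
    assert (L2 := Rmin_r (eta0 / 2) (Rmin 1 (Rmin t0 (2 * PI - t0)))).
    assert (L3 := Rmin_l 1 (Rmin t0 (2 * PI - t0))).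
    assert (L4 := Rmin_r 1 (Rmin t0 (2 * PI - t0))).
    assert (L5 := Rmin_l t0 (2 * PI - t0)). assert (L6 := Rmin_r t0 (2 * PI - t0)).
    assert (0 < Rmin (eta0 / 2) (Rmin 1 (Rmin t0 (2 * PI - t0)))).
    { repeat apply Rmin_glb_lt; lra. }
    lra. }
  destruct Heta as [eta Heta].
  destruct (continuity_ab_min k 0 (2 * PI)) as [mn [Hmn _]]; [lra | |].
  { intros c _. apply continuity_pt_filterlim. apply Hk. }
  set (B := Rabs (k mn)). assert (HB0 : 0 <= B) by apply Rabs_pos.
  assert (HB : forall t, 0 <= t <= 2 * PI -> - B <= k t).
  { intros t Ht. apply Rle_trans with (2 := Hmn t Ht).
    assert (H := Rle_abs (- k mn)). rewrite Rabs_Ropp in H. fold B in H. lra. }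
  set (q1 := (1 + cos (eta / 2)) / 2). set (q2 := (1 + cos eta) / 2).
  assert (Hq : 0 <= q2 < q1).
  { assert (H1 := COS_bound eta).
    assert (cos eta < cos (eta / 2)) by (apply cos_decreasing_1; lra).
    unfold q1, q2. lra. }
  assert (Hq0 : 0 <= q2 / q1 < 1).
  { split; [apply Rdiv_le_0_compat; lra |]. apply Rmult_lt_reg_r with q1; [lra |].
    unfold Rdiv. rewrite Rmult_assoc, Rinv_l; lra. }
  assert (Hnear1 : forall t, Rabs (t - t0) <= eta / 2 -> q1 <= bump t0 t).
  { intros t Ht. rewrite bump_eq. unfold q1.
    assert (cos (eta / 2) <= cos (t - t0)); [| lra].
    assert (Hcos : cos (t - t0) = cos (Rabs (t - t0))).
    { unfold Rabs. destruct (Rcase_abs (t - t0)); [now rewrite cos_neg | reflexivity]. }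
    rewrite Hcos. apply cos_decr_1; try lra. apply Rabs_pos. }
  assert (Hfar : forall t, eta <= Rabs (t - t0) <= 2 * PI - eta -> bump t0 t <= q2).
  { intros t Ht. rewrite bump_eq. unfold q2.
    assert (cos (t - t0) <= cos eta); [| lra].
    assert (Hcos : cos (t - t0) = cos (Rabs (t - t0))).
    { unfold Rabs. destruct (Rcase_abs (t - t0)); [now rewrite cos_neg | reflexivity]. }
    rewrite Hcos. set (a := Rabs (t - t0)) in *. destruct (Rle_dec a PI).
    - apply cos_decr_1; lra.
    - replace (cos a) with (cos (2 * PI - a)).
      + apply cos_decr_1; lra.
      + rewrite cos_minus, cos_2PI, sin_2PI. ring. }
  assert (Hb : forall t, 0 <= bump t0 t).
  { intros t. rewrite bump_eq. assert (H := COS_bound (t - t0)). lra. }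
  set (D := k t0 / 2).
  (* [n] makes the far loss, at most 2 pi B q2^n, smaller than the central gain D eta q1^n; the
     added 1 keeps the denominator positive when B = 0. *)
  destruct (pow_lt_1_zero (q2 / q1) ltac:(rewrite Rabs_pos_eq; lra)
    (D * eta / (2 * PI * B + 1)) ltac:(unfold D; apply Rdiv_lt_0_compat; nra)) as [n Hn].
  specialize (Hn n (le_n n)). rewrite Rabs_pos_eq in Hn by (apply pow_le; lra).
  exists n.
  set (g := fun t => k t * bump t0 t ^ n).
  assert (Hex : forall a b, ex_RInt g a b).
  { intros a b. apply (ex_RInt_continuous g). intros t _.
    apply (continuous_mult (K := R_AbsRing) k (fun t => bump t0 t ^ n)); [apply Hk |].
    apply trig_poly_continuous, bump_trig_poly. }
  assert (Hlow : forall a b, 0 <= a <= b -> b <= 2 * PI ->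
    (forall t, a < t < b -> eta <= Rabs (t - t0) <= 2 * PI - eta) ->
    - B * q2 ^ n * (b - a) <= RInt g a b).
  { intros a b Hab Hb2 Hf. apply RInt_ge_const; [lra | apply Hex |]. intros t Ht. unfold g.
    assert (H1 : 0 <= bump t0 t ^ n <= q2 ^ n).
    { split; [now apply pow_le |]. apply pow_incr. split; [apply Hb |]. now apply Hfar, Hf. }
    assert (H2 := HB t ltac:(lra)). nra. }
  assert (Hmid : forall a b, a <= b -> (forall t, a < t < b -> Rabs (t - t0) < eta0) ->
    0 * (b - a) <= RInt g a b).
  { intros a b Hab Hf. apply RInt_ge_const; [lra | apply Hex |]. intros t Ht. unfold g.
    apply Rmult_le_pos; [| now apply pow_le]. assert (H := Hnear' t (Hf t Ht)). lra. }
  rewrite <- (RInt_Chasles g 0 (t0 - eta) (2 * PI)) by apply Hex.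
  rewrite <- (RInt_Chasles g (t0 - eta) (t0 - eta / 2) (2 * PI)) by apply Hex.
  rewrite <- (RInt_Chasles g (t0 - eta / 2) (t0 + eta / 2) (2 * PI)) by apply Hex.
  rewrite <- (RInt_Chasles g (t0 + eta / 2) (t0 + eta) (2 * PI)) by apply Hex.
  unfold plus; simpl.
  assert (I1 : - B * q2 ^ n * (t0 - eta - 0) <= RInt g 0 (t0 - eta)).
  { apply Hlow; try lra. intros t Ht. rewrite Rabs_left by lra. lra. }
  assert (I2 : 0 * (t0 - eta / 2 - (t0 - eta)) <= RInt g (t0 - eta) (t0 - eta / 2)).
  { apply Hmid; [lra |]. intros t Ht. apply Rabs_def1; lra. }
  assert (I3 : D * q1 ^ n * (t0 + eta / 2 - (t0 - eta / 2)) <= RInt g (t0 - eta / 2) (t0 + eta / 2)).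
  { apply RInt_ge_const; [lra | apply Hex |]. intros t Ht. unfold g.
    assert (H : Rabs (t - t0) < eta / 2) by (apply Rabs_def1; lra).
    apply Rmult_le_compat; [unfold D; lra | apply pow_le; lra | unfold D; apply Hnear'; lra |].
    apply pow_incr. split; [lra |]. apply Hnear1. lra. }
  assert (I4 : 0 * (t0 + eta - (t0 + eta / 2)) <= RInt g (t0 + eta / 2) (t0 + eta)).
  { apply Hmid; [lra |]. intros t Ht. apply Rabs_def1; lra. }
  assert (I5 : - B * q2 ^ n * (2 * PI - (t0 + eta)) <= RInt g (t0 + eta) (2 * PI)).
  { apply Hlow; try lra. intros t Ht. rewrite Rabs_pos_eq by lra. lra. }
  assert (Hq1n : 0 < q1 ^ n) by (apply pow_lt; lra).
  assert (Hq2n : q2 ^ n = (q2 / q1) ^ n * q1 ^ n).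
  { rewrite <- Rpow_mult_distr. f_equal. field. lra. }
  assert (HBq : 2 * PI * B * q2 ^ n < D * eta * q1 ^ n).
  { rewrite Hq2n, <- Rmult_assoc. apply Rmult_lt_compat_r; [exact Hq1n |].
    assert (Hq3 : 0 <= (q2 / q1) ^ n) by (apply pow_le; lra).
    assert (HPB : 0 <= 2 * PI * B) by nra.
    apply Rle_lt_trans with ((2 * PI * B + 1) * (q2 / q1) ^ n); [nra |].
    apply Rmult_lt_compat_l with (r := 2 * PI * B + 1) in Hn; [| lra].
    replace ((2 * PI * B + 1) * (D * eta / (2 * PI * B + 1))) with (D * eta) in Hn
      by (field; lra). exact Hn. }
  assert (Hq2p : 0 <= B * q2 ^ n) by (apply Rmult_le_pos; [lra | apply pow_le; lra]).
  nra.
Qed.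

(** [RInt_bump_pos] needs room on both sides of its point. A positive value at an endpoint of the
    period persists nearby, so the point is moved towards the roomier side. *)
Lemma interior_pos (k : R -> R) (t0 : R) : (forall t, continuous k t) ->
  0 <= t0 <= 2 * PI -> 0 < k t0 -> exists t1, 0 < t1 < 2 * PI /\ 0 < k t1.
Proof.
  intros Hk Ht0 Hk0. assert (HPI2 := PI2_1).
  destruct (proj1 (filterlim_locally _ _) (Hk t0) (mkposreal _ Hk0)) as [[eta Heta] Hnear].
  assert (Hnear' : forall t, Rabs (t - t0) < eta -> 0 < k t).
  { intros t Ht. assert (H := Hnear t Ht).
    change (Rabs (k t - k t0) < k t0) in H. apply Rabs_def2 in H. lra. }
  assert (L1 := Rmin_l (eta / 2) 1). assert (L2 := Rmin_r (eta / 2) 1).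
  assert (L3 : 0 < Rmin (eta / 2) 1) by (apply Rmin_glb_lt; lra).
  destruct (Rle_dec t0 PI).
  - exists (t0 + Rmin (eta / 2) 1). split; [lra |]. apply Hnear'. apply Rabs_def1; lra.
  - exists (t0 - Rmin (eta / 2) 1). split; [lra |]. apply Hnear'. apply Rabs_def1; lra.
Qed.

Lemma CInt_parts (g : R -> C) (a b : R) :
  (forall t, continuous (fun t => Re (g t)) t) ->
  (forall t, continuous (fun t => Im (g t)) t) ->
  CInt g a b = (RInt (fun t => Re (g t)) a b, RInt (fun t => Im (g t)) a b).
Proof.
  intros Hre Him.
  destruct (ex_RInt_continuous (fun t => Re (g t)) a b (fun t _ => Hre t)) as [u Hu].
  destruct (ex_RInt_continuous (fun t => Im (g t)) a b (fun t _ => Him t)) as [v Hv].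
  rewrite (is_RInt_unique _ _ _ _ Hu), (is_RInt_unique _ _ _ _ Hv).
  apply (is_RInt_unique (V := C_R_CompleteNormedModule)).
  now apply (is_RInt_fct_extend_pair g a b u v).
Qed.

(** Turns a complex pairing with a real weight into one real integral, where pointwise inequalities
    can be integrated. *)
Lemma linear_CInt_RtoC (g : R -> C) (w : R -> R) (u v a b : R) :
  (forall t, continuous g t) -> (forall t, continuous w t) ->
  u * Re (CInt (fun t => (g t * RtoC (w t))%C) a b)
    + v * Im (CInt (fun t => (g t * RtoC (w t))%C) a b)
  = RInt (fun t => (u * Re (g t) + v * Im (g t)) * w t) a b.
Proof.
  intros Hg Hw.
  assert (Hre : forall t, continuous (fun t => Re (g t) * w t) t).
  { intros t. apply (continuous_mult (K := R_AbsRing) (fun t => Re (g t))); [now apply continuous_Re | apply Hw]. }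
  assert (Him : forall t, continuous (fun t => Im (g t) * w t) t).
  { intros t. apply (continuous_mult (K := R_AbsRing) (fun t => Im (g t))); [now apply continuous_Im | apply Hw]. }
  assert (E : CInt (fun t => (g t * RtoC (w t))%C) a b
    = (RInt (fun t => Re (g t) * w t) a b, RInt (fun t => Im (g t) * w t) a b)).
  { rewrite CInt_parts.
    - f_equal; apply RInt_ext; intros t _; unfold Re, Im, Cmult; simpl; ring_R.
    - intros t. apply continuous_ext with (2 := Hre t). intros s. unfold Re, Im, Cmult; simpl; ring_R.
    - intros t. apply continuous_ext with (2 := Him t). intros s. unfold Re, Im, Cmult; simpl; ring_R. }
  rewrite E. simpl Re. simpl Im.
  assert (Ere : ex_RInt (fun t => Re (g t) * w t) a b)
    by (apply (ex_RInt_continuous (fun t => Re (g t) * w t)); auto).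
  assert (Eim : ex_RInt (fun t => Im (g t) * w t) a b)
    by (apply (ex_RInt_continuous (fun t => Im (g t) * w t)); auto).
  symmetry. apply is_RInt_unique.
  apply is_RInt_ext with (fun t => plus (scal u (Re (g t) * w t)) (scal v (Im (g t) * w t))).
  { intros t _. unfold plus, scal; simpl. unfold mult; simpl. ring_R. }
  apply (is_RInt_plus (fun t => scal u (Re (g t) * w t)) (fun t => scal v (Im (g t) * w t))).
  - apply (is_RInt_scal (fun t => Re (g t) * w t) a b u).
    now apply (RInt_correct (V := R_CompleteNormedModule)).
  - apply (is_RInt_scal (fun t => Im (g t) * w t) a b v).
    now apply (RInt_correct (V := R_CompleteNormedModule)).
Qed.

(** If |f*| > 1 at [t0], project onto the direction (u, v) of that value. The projection of f*
    exceeds 1 near [t0], whereas that of f_r never does. A weight concentrated near [t0] detects the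
    difference, and a distributional limit preserves the inequality. *)
Lemma boundary_le_1 (alpha M : R) (f fstar : C -> C) :
  -1 < alpha -> boundary_function alpha f fstar ->
  continuous_on unit_circle fstar ->
  (forall t, 0 <= t <= 2 * PI -> Cmod (fstar (cis t)) <= M) ->
  (forall z, unit_disk z -> unit_disk (f z)) ->
  forall t, 0 <= t <= 2 * PI -> Cmod (fstar (cis t)) <= 1.
Proof.
  intros Hal [Hlim Hf] Hc HM Hdisk t0 Ht0. assert (Hpi := PI_RGT_0).
  apply Rnot_lt_le. intros Hgt.
  set (m := Cmod (fstar (cis t0))) in *.
  set (u := Re (fstar (cis t0)) / m). set (v := Im (fstar (cis t0)) / m).
  assert (Hmm := Cmod_sqr (fstar (cis t0))). fold m in Hmm.
  assert (Huv : u ^ 2 + v ^ 2 = 1).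
  { unfold u, v. transitivity ((Re (fstar (cis t0)) ^ 2 + Im (fstar (cis t0)) ^ 2) / m ^ 2).
    - field. lra.
    - rewrite <- Hmm. field. lra. }
  assert (Hg : forall t, continuous (fun t => fstar (cis t)) t)
    by (intros t; now apply continuous_on_circle).
  set (k := fun t => u * Re (fstar (cis t)) + v * Im (fstar (cis t)) - 1).
  assert (Hk : forall t, continuous k t).
  { intros t. apply (continuous_minus (fun t => u * Re (fstar (cis t)) + v * Im (fstar (cis t))) (fun _ => 1));
      [| apply continuous_const].
    apply (continuous_plus (fun t => u * Re (fstar (cis t))) (fun t => v * Im (fstar (cis t)))).
    - apply (continuous_scal_r u (fun t => Re (fstar (cis t)))). now apply continuous_Re.
    - apply (continuous_scal_r v (fun t => Im (fstar (cis t)))). now apply continuous_Im. }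
  assert (Hk0 : 0 < k t0).
  { unfold k. replace (u * Re (fstar (cis t0)) + v * Im (fstar (cis t0))) with m; [lra |].
    unfold u, v. transitivity (m ^ 2 / m); [field; lra |]. rewrite Hmm. field. lra. }
  destruct (interior_pos k t0 Hk Ht0 Hk0) as [t1 [Ht1 Hk1]].
  destruct (RInt_bump_pos k t1 Hk Ht1 Hk1) as [n Hn].
  set (w := fun t => bump t1 t ^ n) in *.
  assert (Hw : forall t, continuous w t)
    by (intros t; apply trig_poly_continuous, bump_trig_poly).
  assert (Hw0 : forall t, 0 <= w t).
  { intros t. apply pow_le. rewrite bump_eq. assert (H := COS_bound (t - t1)). lra. }
  assert (Hwex : ex_RInt w 0 (2 * PI)) by (apply (ex_RInt_continuous w); auto).
  (* A polynomial in the coordinates of z whose restriction to the circle is convertible to [w]. *)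
  set (phi := fun z : C => RtoC ((/ 2 + / 2 * (cos t1 * Re z + sin t1 * Im z)) ^ n)).
  assert (Hphi : forall t, phi (cis t) = RtoC (w t)) by reflexivity.
  assert (Htest : test_function phi).
  { intros j t. split.
    - apply (trig_poly_ex_derive_n w). apply bump_trig_poly.
    - apply (ex_derive_n_const 0). }
  specialize (Hlim phi Htest).
  set (lin := fun z : C => u * Re z + v * Im z).
  assert (Hlin : filterlim (fun r => lin (circle_pairing (fun z => f (RtoC r * z)%C) phi))
    (at_left 1) (locally (lin (circle_pairing fstar phi)))).
  { apply (filterlim_comp _ _ _ _ lin _ _ _ Hlim).
    set (l := circle_pairing fstar phi).
    change (continuous lin l).
    apply (continuous_plus (fun z : C => u * Re z) (fun z : C => v * Im z)).
    - apply (continuous_scal_r u (fun z : C => Re z)). apply continuous_fst.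
    - apply (continuous_scal_r v (fun z : C => Im z)). apply continuous_snd. }
  (* The bound holds for each 0 < r < 1 and passes to the limit of the pairings; no pointwise
     convergence of f_r is involved. *)
  assert (Hle : Rbar_le (lin (circle_pairing fstar phi)) (RInt w 0 (2 * PI))).
  { apply (filterlim_le (F := at_left 1) (fun r => lin (circle_pairing (fun z => f (RtoC r * z)%C) phi))
      (fun _ => RInt w 0 (2 * PI))).
    - exists (mkposreal 1 Rlt_0_1). intros r Hr Hr1.
      change (Rabs (r - 1) < 1) in Hr. apply Rabs_def2 in Hr.
      assert (Hfc : forall t, continuous (fun t => f (RtoC r * cis t)%C) t)
        by (intros t; apply (poisson_continuous_circle alpha M r f fstar); try assumption; lra).
      unfold lin, circle_pairing.
      change (u * Re (CInt (fun t => (f (RtoC r * cis t) * RtoC (w t))%C) 0 (2 * PI))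
        + v * Im (CInt (fun t => (f (RtoC r * cis t) * RtoC (w t))%C) 0 (2 * PI))
        <= RInt w 0 (2 * PI)).
      rewrite (linear_CInt_RtoC (fun t => f (RtoC r * cis t)%C) w) by assumption.
      apply RInt_le; [lra | | exact Hwex |].
      + apply (ex_RInt_continuous (fun t => (u * Re (f (RtoC r * cis t)%C) + v * Im (f (RtoC r * cis t)%C)) * w t)).
        intros t _. apply (continuous_mult (K := R_AbsRing)
          (fun t => u * Re (f (RtoC r * cis t)%C) + v * Im (f (RtoC r * cis t)%C)) w); [| apply Hw].
        apply (continuous_plus (fun t => u * Re (f (RtoC r * cis t)%C)) (fun t => v * Im (f (RtoC r * cis t)%C))).
        * apply (continuous_scal_r u (fun t => Re (f (RtoC r * cis t)%C))). now apply continuous_Re.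
        * apply (continuous_scal_r v (fun t => Im (f (RtoC r * cis t)%C))). now apply continuous_Im.
      + intros t _.
        assert (Hd : unit_disk (f (RtoC r * cis t)%C)).
        { apply Hdisk. unfold unit_disk. rewrite Cmod_mult, Cmod_cis, Cmod_R, Rabs_pos_eq; lra. }
        unfold unit_disk in Hd. assert (Hs := Cmod_sqr (f (RtoC r * cis t)%C)).
        assert (H0 := Cmod_ge_0 (f (RtoC r * cis t)%C)).
        set (F := f (RtoC r * cis t)%C) in *.
        assert (u * Re F + v * Im F <= 1).
        { assert (Re F ^ 2 + Im F ^ 2 <= 1) by nra.
          assert (0 <= (u - Re F) ^ 2 + (v - Im F) ^ 2)
            by (apply Rplus_le_le_0_compat; apply pow2_ge_0).
          nra. }
        specialize (Hw0 t). nra.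
    - exact Hlin.
    - apply filterlim_const. }
  simpl in Hle. unfold lin, circle_pairing in Hle.
  change (u * Re (CInt (fun t => (fstar (cis t) * RtoC (w t))%C) 0 (2 * PI))
    + v * Im (CInt (fun t => (fstar (cis t) * RtoC (w t))%C) 0 (2 * PI))
    <= RInt w 0 (2 * PI)) in Hle.
  rewrite (linear_CInt_RtoC (fun t => fstar (cis t)) w) in Hle by assumption.
  assert (Hex : ex_RInt (fun t => k t * w t) 0 (2 * PI)).
  { apply (ex_RInt_continuous (fun t => k t * w t)). intros t _.
    apply (continuous_mult (K := R_AbsRing) k w); auto. }
  assert (E : RInt (fun t => (u * Re (fstar (cis t)) + v * Im (fstar (cis t))) * w t) 0 (2 * PI)
    = RInt (fun t => k t * w t) 0 (2 * PI) + RInt w 0 (2 * PI)).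
  { rewrite <- (RInt_plus (fun t => k t * w t) w) by assumption.
    apply RInt_ext. intros t _. unfold plus, k; simpl. ring_R. }
  rewrite E in Hle. change (0 < RInt (fun t => k t * w t) 0 (2 * PI)) in Hn. lra.
Qed.

(** * Hyperbolic length *)

(** The radius [h0] is uniform over 1 - |z|^2 >= kappa0, so one mesh serves a whole curve, whose
    trace is compact in the disk. *)
Lemma poisson_infinitesimal (alpha kappa0 eta : R) (f fstar : C -> C) :
  -1 < alpha -> poisson_represented alpha f fstar ->
  continuous_on unit_circle fstar ->
  (forall t, 0 <= t <= 2 * PI -> Cmod (fstar (cis t)) <= 1) ->
  0 < kappa0 -> 0 < eta ->
  exists h0, 0 < h0 /\ forall z w : C,
    kappa0 <= 1 - Cmod z ^ 2 -> Cmod (w - z) < h0 ->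
    Cmod (f w - f z)%C
    <= (alpha + 2) / c_const alpha * (1 + eta) * (2 / (1 - Cmod z ^ 2) * Cmod (w - z)%C).
Proof.
  intros Hal Hf Hc HB Hk0 Heta.
  (* [theta h] collects the two losses of a step of length h: the exponential factor, and m / (m - 3
     h) with m = 1 - |z|^2, which is largest at m = kappa0. Both tend to 1. *)
  set (theta := fun h => exp (2 * (alpha + 2) * h / (kappa0 - 3 * h)) * (kappa0 / (kappa0 - 3 * h))).
  assert (Hth : continuous theta 0).
  { apply (ex_derive_continuous theta). unfold theta. auto_derive. repeat split; lra. }
  destruct (proj1 (filterlim_locally _ _) Hth (mkposreal _ Heta)) as [[h1 Hh1] Hnear].
  assert (Hnear' : forall h, 0 <= h < h1 -> theta h <= 1 + eta).
  { intros h Hh. assert (H : Rabs (h - 0) < h1) by (apply Rabs_def1; lra).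
    apply (Hnear h) in H. change (Rabs (theta h - theta 0) < eta) in H.
    assert (E : theta 0 = 1).
    { unfold theta. replace (2 * (alpha + 2) * 0 / (kappa0 - 3 * 0)) with 0 by (field; lra).
      rewrite exp_0. field. lra. }
    rewrite E in H. apply Rabs_def2 in H. lra. }
  clear Hnear.
  exists (Rmin h1 (Rmin 1 (kappa0 / 4))).
  assert (L1 := Rmin_l h1 (Rmin 1 (kappa0 / 4))). assert (L2 := Rmin_r h1 (Rmin 1 (kappa0 / 4))).
  assert (L3 := Rmin_l 1 (kappa0 / 4)). assert (L4 := Rmin_r 1 (kappa0 / 4)).
  split; [repeat apply Rmin_glb_lt; lra |].
  intros z w Hz Hw. set (h := Cmod (w - z)%C) in *.
  assert (Hh : 0 <= h) by apply Cmod_ge_0.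
  set (m := 1 - Cmod z ^ 2) in *.
  assert (Hz0 := Cmod_ge_0 z).
  assert (Hz1 : Cmod z < 1) by (unfold m in Hz; nra).
  assert (Hcc := c_const_pos alpha Hal).
  (* On the segment the squared modulus is at most (|z| + h)^2 <= |z|^2 + 3 h, because |z| < 1 and h
     <= 1. *)
  assert (HL := poisson_lipschitz alpha (m - 3 * h) 1 f fstar z (w - z) Hal ltac:(lra) Hf Hc HB).
  replace (z + (w - z))%C with w in HL by ring. fold h in HL.
  assert (HL' : Cmod (f w - f z) <= 1 / c_const alpha
    * (2 * (alpha + 2) / (m - 3 * h) * h * exp (2 * (alpha + 2) / (m - 3 * h) * h))).
  { apply HL. intros tau Htau.
    assert (H : Cmod (z + RtoC tau * (w - z)) <= Cmod z + h).
    { apply Rle_trans with (1 := Cmod_triangle _ _). apply Rplus_le_compat_l.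
      rewrite Cmod_mult, Cmod_R, Rabs_pos_eq by lra. fold h. nra. }
    apply Rle_trans with ((Cmod z + h) ^ 2).
    - apply pow_incr. split; [apply Cmod_ge_0 | exact H].
    - unfold m. nra. }
  apply Rle_trans with (1 := HL').
  assert (Hexp : exp (2 * (alpha + 2) / (m - 3 * h) * h)
    <= exp (2 * (alpha + 2) * h / (kappa0 - 3 * h))).
  { assert (H : 2 * (alpha + 2) / (m - 3 * h) * h <= 2 * (alpha + 2) * h / (kappa0 - 3 * h)).
    { unfold Rdiv. replace (2 * (alpha + 2) * / (m - 3 * h) * h)
        with (2 * (alpha + 2) * h * / (m - 3 * h)) by ring.
      apply Rmult_le_compat_l; [repeat apply Rmult_le_pos; lra |].
      apply Rinv_le_contravar; lra. }
    destruct H as [H | H]; [left; now apply exp_increasing | right; now f_equal]. }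
  assert (Hinv : / (m - 3 * h) <= kappa0 / (kappa0 - 3 * h) * / m).
  { apply Rmult_le_reg_r with ((m - 3 * h) * (kappa0 - 3 * h) * m).
    - repeat apply Rmult_lt_0_compat; lra.
    - replace (/ (m - 3 * h) * ((m - 3 * h) * (kappa0 - 3 * h) * m)) with ((kappa0 - 3 * h) * m)
        by (field; lra).
      replace (kappa0 / (kappa0 - 3 * h) * / m * ((m - 3 * h) * (kappa0 - 3 * h) * m))
        with (kappa0 * (m - 3 * h)) by (field; lra).
      nra. }
  assert (Ht := Hnear' h ltac:(lra)). unfold theta in Ht.
  set (e := exp (2 * (alpha + 2) * h / (kappa0 - 3 * h))) in *.
  set (e' := exp (2 * (alpha + 2) / (m - 3 * h) * h)) in *.
  assert (He' : 0 < e') by apply exp_pos.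
  assert (Him : 0 < / m) by (apply Rinv_0_lt_compat; lra).
  assert (Hi3 : 0 < / (m - 3 * h)) by (apply Rinv_0_lt_compat; lra).
  assert (H : e' * / (m - 3 * h) <= (1 + eta) * / m).
  { apply Rle_trans with (e * (kappa0 / (kappa0 - 3 * h) * / m)).
    - apply Rmult_le_compat; lra.
    - rewrite <- Rmult_assoc. apply Rmult_le_compat_r; lra. }
  apply Rmult_le_compat_l with (r := 2 * (alpha + 2) * h / c_const alpha) in H.
  2:{ apply Rmult_le_pos; [repeat apply Rmult_le_pos; lra | left; now apply Rinv_0_lt_compat]. }
  unfold Rdiv in *. lra.
Qed.

(** A curve is continuous only relative to [0, 1], while the extreme value and Heine theorems ask
    for continuity at each point of the line; clamping the parameter is 1-Lipschitz and gives such
    an extension. *)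
Lemma curve_continuous_extension (gamma : R -> C) :
  continuous_on (fun t : R => 0 <= t <= 1) gamma ->
  forall t, continuous (fun t => gamma (Rmax 0 (Rmin 1 t))) t.
Proof.
  intros Hg t.
  assert (Hcl : forall t, 0 <= Rmax 0 (Rmin 1 t) <= 1).
  { intros s. split; [apply Rmax_l |]. apply Rmax_lub; [lra | apply Rmin_l]. }
  apply (filterlim_comp _ _ _ (fun t => Rmax 0 (Rmin 1 t)) gamma _
    (within (fun t : R => 0 <= t <= 1) (locally (Rmax 0 (Rmin 1 t))))); [| now apply Hg].
  assert (Hc : continuous (fun t => Rmax 0 (Rmin 1 t)) t).
  { apply filterlim_locally. intros [eps He]. exists (mkposreal _ He). intros s Hs.
    change (Rabs (s - t) < eps) in Hs.
    change (Rabs (Rmax 0 (Rmin 1 s) - Rmax 0 (Rmin 1 t)) < eps).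
    apply Rle_lt_trans with (2 := Hs).
    apply Rle_trans with (Rabs (Rmin 1 s - Rmin 1 t)).
    - set (a := Rmin 1 s). set (b := Rmin 1 t). unfold Rmax.
      destruct (Rle_dec 0 a); destruct (Rle_dec 0 b); split_Rabs; lra.
    - unfold Rmin. destruct (Rle_dec 1 s); destruct (Rle_dec 1 t); split_Rabs; lra. }
  intros P HP. apply Hc in HP. unfold filtermap in *.
  apply filter_imp with (2 := HP). intros s Hs. apply Hs, Hcl.
Qed.

Lemma uniform_subdivision (N : nat) : Defs.subdivision N (fun i => INR i / INR (S N)).
Proof.
  assert (HN : 0 < INR (S N)) by (apply lt_0_INR; lia).
  split; [| split].
  - simpl INR at 1. field. lra.
  - field. lra.
  - intros i _. apply Rmult_le_compat_r; [left; now apply Rinv_0_lt_compat |].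
    apply le_INR. lia.
Qed.

Lemma subdivision_bounds (n : nat) (x : nat -> R) : Defs.subdivision n x ->
  forall i, (i <= S n)%nat -> 0 <= x i <= 1.
Proof.
  intros [H0 [H1 Hx]].
  assert (Hup : forall i, (i <= S n)%nat -> 0 <= x i).
  { induction i as [|i IH]; intros Hi; [lra |].
    apply Rle_trans with (1 := IH ltac:(lia)). apply Hx. lia. }
  assert (Hdn : forall j, (j <= S n)%nat -> x (S n - j)%nat <= 1).
  { induction j as [|j IH]; intros Hj; [rewrite Nat.sub_0_r; lra |].
    apply Rle_trans with (2 := IH ltac:(lia)).
    replace (S n - j)%nat with (S (S n - S j))%nat by lia. apply Hx. lia. }
  intros i Hi. split; [now apply Hup |].
  replace i with (S n - (S n - i))%nat by lia. apply Hdn. lia.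
Qed.

Lemma sum_n_le_ext (u v : nat -> R) (n : nat) :
  (forall i, (i <= n)%nat -> u i <= v i) -> sum_n u n <= sum_n v n.
Proof.
  induction n as [|n IH]; intros H.
  - rewrite !sum_O. now apply H.
  - rewrite !sum_Sn. apply Rplus_le_compat; [| now apply H].
    apply IH. intros i Hi. apply H. lia.
Qed.

Lemma Cmod_telescope (g : nat -> C) (n : nat) :
  Cmod (g (S n) - g O)%C <= sum_n (fun i => Cmod (g (S i) - g i)%C) n.
Proof.
  induction n as [|n IH]; [rewrite sum_O; lra |].
  rewrite sum_Sn. unfold plus; simpl.
  replace (g (S (S n)) - g 0%nat)%C with ((g (S n) - g 0%nat) + (g (S (S n)) - g (S n)))%C by ring.
  apply Rle_trans with (1 := Cmod_triangle _ _). lra.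
Qed.

Lemma Cmod_diff_lt (z w : C) (e : R) :
  Rabs (Re z - Re w) < e / 2 -> Rabs (Im z - Im w) < e / 2 -> Cmod (z - w)%C < e.
Proof.
  intros H1 H2. destruct z as [a b]. destruct w as [c d]. simpl in H1, H2.
  assert (He : 0 < e) by (assert (H := Rabs_pos (a - c)); lra).
  apply Rsqr_incrst_0; [| apply Cmod_ge_0 | lra]. unfold Rsqr.
  replace (Cmod _ * Cmod _) with (Cmod ((a, b) - (c, d))%C ^ 2) by ring.
  rewrite Cmod_sqr. simpl. apply Rabs_def2 in H1, H2. nra.
Qed.

(** Compactness of the trace gives kappa0, and uniform continuity makes all chords of a fine
    subdivision shorter than [h0]. Summing the local estimates gives (1 + eta) times an arc sum
    within eta of [L]; then eta tends to 0. *)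
Lemma arc_integral_ge (alpha L : R) (f fstar : C -> C) (z1 z2 : C) (gamma : R -> C) :
  -1 < alpha -> poisson_represented alpha f fstar ->
  continuous_on unit_circle fstar ->
  (forall t, 0 <= t <= 2 * PI -> Cmod (fstar (cis t)) <= 1) ->
  curve_in unit_disk z1 z2 gamma ->
  is_arc_integral (fun z => 2 / (1 - Cmod z ^ 2)) gamma L ->
  Cmod (f z1 - f z2)%C <= (alpha + 2) / c_const alpha * L.
Proof.
  intros Hal Hf Hc HB [Hgc [HgD [Hg0 Hg1]]] HL.
  set (K := (alpha + 2) / c_const alpha).
  assert (HK : 0 < K) by (apply Rdiv_lt_0_compat; [lra | now apply c_const_pos]).
  set (gc := fun t => gamma (Rmax 0 (Rmin 1 t))).
  assert (Hgcc : forall t, continuous gc t) by now apply curve_continuous_extension.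
  assert (Hgce : forall t, 0 <= t <= 1 -> gc t = gamma t).
  { intros t Ht. unfold gc. rewrite Rmin_right, Rmax_right by lra. reflexivity. }
  assert (Hre : forall t, continuity_pt (fun t => Re (gc t)) t)
    by (intros t; apply continuity_pt_filterlim; now apply continuous_Re).
  assert (Him : forall t, continuity_pt (fun t => Im (gc t)) t)
    by (intros t; apply continuity_pt_filterlim; now apply continuous_Im).
  destruct (continuity_ab_maj (fun t => Cmod (gc t) ^ 2) 0 1) as [tm [Hmax Htm]]; [lra | |].
  { intros t _. apply continuity_pt_ext with (fun t => Re (gc t) * Re (gc t) + Im (gc t) * Im (gc t)).
    - intros s. rewrite Cmod_sqr. ring.
    - apply (continuity_pt_plus (fun t => Re (gc t) * Re (gc t)) (fun t => Im (gc t) * Im (gc t)));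
      [now apply (continuity_pt_mult (fun t => Re (gc t)) (fun t => Re (gc t)))
      |now apply (continuity_pt_mult (fun t => Im (gc t)) (fun t => Im (gc t)))]. }
  set (kappa0 := 1 - Cmod (gc tm) ^ 2).
  assert (Hk0 : 0 < kappa0).
  { assert (H := HgD tm Htm). rewrite <- Hgce in H by exact Htm. unfold unit_disk in H.
    assert (H0 := Cmod_ge_0 (gc tm)). unfold kappa0. nra. }
  assert (Hkap : forall t, 0 <= t <= 1 -> kappa0 <= 1 - Cmod (gamma t) ^ 2).
  { intros t Ht. assert (H := Hmax t Ht). simpl in H. rewrite <- (Hgce t Ht). unfold kappa0. simpl. lra. }
  assert (Hmain : forall eta, 0 < eta -> Cmod (f z1 - f z2)%C <= K * (1 + eta) * (L + eta)).
  { intros eta Heta.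
    destruct (poisson_infinitesimal alpha kappa0 eta f fstar Hal Hf Hc HB Hk0 Heta)
      as [h0 [Hh0 Hloc]].
    destruct (HL eta Heta) as [delta [Hdelta Hsum]].
    assert (Hh2 : 0 < h0 / 2) by lra.
    destruct (@Heine_cor2 (fun t => Re (gc t)) 0 1 (fun t _ => Hre t) (mkposreal _ Hh2)) as [[d1 Hd1] Hu1].
    destruct (@Heine_cor2 (fun t => Im (gc t)) 0 1 (fun t _ => Him t) (mkposreal _ Hh2)) as [[d2 Hd2] Hu2].
    simpl in Hu1, Hu2.
    set (mesh := Rmin delta (Rmin d1 d2)).
    assert (M1 := Rmin_l delta (Rmin d1 d2)). assert (M2 := Rmin_r delta (Rmin d1 d2)).
    assert (M3 := Rmin_l d1 d2). assert (M4 := Rmin_r d1 d2). fold mesh in M1, M2.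
    assert (Hmesh : 0 < mesh) by (repeat apply Rmin_glb_lt; lra).
    destruct (archimed_cor1 mesh Hmesh) as [N' [HN1 HN2]].
    destruct N' as [|N]; [lia |]. clear HN2.
    set (x := fun i => INR i / INR (S N)).
    assert (Hx : Defs.subdivision N x) by apply uniform_subdivision.
    assert (HN : 0 < INR (S N)) by (apply lt_0_INR; lia).
    assert (Hxd : forall i, x (S i) - x i = / INR (S N)).
    { intros i. unfold x. rewrite (S_INR i). field. lra. }
    assert (Hb := subdivision_bounds N x Hx).
    (* The tags are the left endpoints, where the local estimate evaluates the density. *)
    specialize (Hsum N x x Hx).
    assert (Hs : Rabs (sum_n (fun i => 2 / (1 - Cmod (gamma (x i)) ^ 2) * chord gamma x i) N - L) < eta).
    { apply Hsum. intros i Hi. assert (H1 := proj2 (proj2 Hx) i Hi). rewrite Hxd. lra. }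
    apply Rabs_def2 in Hs.
    assert (Hends : Cmod (f z1 - f z2)%C = Cmod (f (gamma (x (S N))) - f (gamma (x O)))%C).
    { destruct Hx as [E0 [E1 _]]. rewrite E0, E1, Hg0, Hg1.
      rewrite <- Cmod_opp. f_equal. ring. }
    rewrite Hends.
    apply Rle_trans with (1 := Cmod_telescope (fun i => f (gamma (x i))) N).
    apply Rle_trans with (sum_n (fun i => K * (1 + eta)
      * (2 / (1 - Cmod (gamma (x i)) ^ 2) * chord gamma x i)) N).
    - apply sum_n_le_ext. intros i Hi. apply Hloc.
      + apply Hkap. apply Hb. lia.
      + assert (B1 := Hb i ltac:(lia)). assert (B2 := Hb (S i) ltac:(lia)).
        assert (Hd : Rabs (x (S i) - x i) < mesh).
        { rewrite Hxd, Rabs_pos_eq by (left; now apply Rinv_0_lt_compat). exact HN1. }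
        rewrite <- !Hgce by assumption.
        apply Cmod_diff_lt; [apply Hu1 | apply Hu2]; try assumption; lra.
    - rewrite (sum_n_mult_l (K := R_Ring) (K * (1 + eta))).
      apply Rmult_le_compat_l; [apply Rmult_le_pos; lra |].
      apply Rlt_le, (Rplus_lt_reg_r (- L)). replace (L + eta + - L) with eta by ring.
      apply Hs. }
  apply le_epsilon. intros eps Heps.
  (* For eta <= 1 the excess K (1 + eta) (L + eta) - K L = eta K (1 + L + eta) is at most eta A. *)
  set (A := K * (2 + Rabs L) + 1).
  assert (HL0 := Rabs_pos L). assert (HL1 := Rle_abs L).
  assert (HA : 0 < A).
  { unfold A. assert (0 <= K * (2 + Rabs L)) by (apply Rmult_le_pos; lra). lra. }
  set (eta := Rmin 1 (eps / A)).
  assert (E1 : eta <= 1) by apply Rmin_l.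
  assert (E2 : eta <= eps / A) by apply Rmin_r.
  assert (E3 : 0 < eta).
  { apply Rmin_glb_lt; [lra |]. now apply Rdiv_lt_0_compat. }
  apply Rle_trans with (1 := Hmain eta E3).
  assert (E4 : eta * A <= eps).
  { apply Rmult_le_compat_r with (r := A) in E2; [| lra].
    replace (eps / A * A) with eps in E2 by (field; lra). exact E2. }
  replace (K * (1 + eta) * (L + eta)) with (K * L + eta * (K * (1 + L + eta))) by ring.
  apply Rplus_le_compat_l. apply Rle_trans with (2 := E4).
  apply Rmult_le_compat_l; [lra |]. unfold A.
  apply Rle_trans with (K * (2 + Rabs L)); [apply Rmult_le_compat_l; lra | lra].
Qed.

(** On a segment each chord is |d| times a parameter increment, so the arc sums are Riemann sums of
    the density along the parameter, multiplied by |d|. *)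
Lemma segment_arc_integral (rho : C -> R) (z d : C) :
  (forall t, 0 <= t <= 1 -> continuous (fun t => rho (z + RtoC t * d)%C) t) ->
  exists L, is_arc_integral rho (fun t => z + RtoC t * d)%C L.
Proof.
  intros Hq. set (q := fun t => rho (z + RtoC t * d)%C) in *.
  exists (Cmod d * RInt q 0 1). intros eps Heps.
  assert (Hd0 := Cmod_ge_0 d).
  (* Adding 1 allows d = 0 and makes the final error |d| e strictly less than eps. *)
  set (e := eps / (Cmod d + 1)).
  assert (He : 0 < e) by (apply Rdiv_lt_0_compat; lra).
  destruct (@Heine_cor2 q 0 1 (fun t Ht => proj2 (continuity_pt_filterlim q t) (Hq t Ht))
    (mkposreal e He)) as [[delta Hdelta] Hunif].
  simpl in Hunif. exists delta. split; [exact Hdelta |].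
  intros n x xi Hx Hxi.
  assert (Hb := subdivision_bounds n x Hx).
  assert (Hex : forall a b, 0 <= a <= 1 -> 0 <= b <= 1 -> ex_RInt q a b).
  { intros a b Ha Hb'. apply (ex_RInt_continuous q). intros t Ht. apply Hq.
    unfold Rmin, Rmax in Ht. destruct (Rle_dec a b); lra. }
  destruct Hx as [Hx0 [Hx1 Hxm]].
  assert (Hpiece : forall i, (i <= n)%nat ->
    Rabs (q (xi i) * (x (S i) - x i) - RInt q (x i) (x (S i))) <= e * (x (S i) - x i)).
  { intros i Hi. destruct (Hxi i Hi) as [B1 B2].
    assert (B3 := Hb i ltac:(lia)). assert (B4 := Hb (S i) ltac:(lia)).
    assert (E : q (xi i) * (x (S i) - x i) - RInt q (x i) (x (S i))
      = RInt (fun t => q (xi i) - q t) (x i) (x (S i))).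
    { rewrite (RInt_minus (fun _ => q (xi i)) q).
      - rewrite RInt_const. unfold minus, plus, opp, scal; simpl. unfold mult; simpl. ring.
      - apply ex_RInt_const.
      - now apply Hex. }
    rewrite E, Rmult_comm. apply abs_RInt_le_const; [lra | |].
    - apply (ex_RInt_minus (fun _ => q (xi i)) q); [apply ex_RInt_const | now apply Hex].
    - intros t Ht. left. apply Hunif; try lra. apply Rabs_def1; lra. }
  assert (Hchord : forall i, (i <= n)%nat ->
    chord (fun t => z + RtoC t * d)%C x i = Cmod d * (x (S i) - x i)).
  { intros i Hi. unfold chord.
    replace (z + RtoC (x (S i)) * d - (z + RtoC (x i) * d))%C
      with (RtoC (x (S i) - x i) * d)%C by (rewrite RtoC_minus; ring).
    assert (H := Hxm i Hi). rewrite Cmod_mult, Cmod_R, Rabs_pos_eq by lra. ring. }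
  (* Partial sums are compared with the integral up to the current node; the error accumulates in
     proportion to the parameter length covered. *)
  assert (Hind : forall m, (m <= n)%nat ->
    Rabs (sum_n (fun i => q (xi i) * chord (fun t => z + RtoC t * d)%C x i) m
      - Cmod d * RInt q 0 (x (S m))) <= Cmod d * (e * x (S m))).
  { induction m as [|m IH]; intros Hm.
    - rewrite sum_O, Hchord by exact Hm. assert (H := Hpiece O Hm). rewrite Hx0 in H |- *.
      rewrite Rminus_0_r in H |- *.
      replace (q (xi 0%nat) * (Cmod d * x 1%nat) - Cmod d * RInt q 0 (x 1%nat))
        with (Cmod d * (q (xi 0%nat) * x 1%nat - RInt q 0 (x 1%nat))) by ring.
      rewrite Rabs_mult, (Rabs_pos_eq (Cmod d)) by exact Hd0.
      now apply Rmult_le_compat_l.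
    - rewrite sum_Sn, Hchord by exact Hm. unfold plus; simpl.
      rewrite <- (RInt_Chasles q 0 (x (S m)) (x (S (S m)))) by (apply Hex; try lra; apply Hb; lia).
      unfold plus; simpl. specialize (IH ltac:(lia)). assert (H := Hpiece (S m) Hm).
      match goal with |- Rabs (?S + ?a * (?D * ?b) - ?D * (?I + ?J)) <= _ =>
        replace (S + a * (D * b) - D * (I + J)) with ((S - D * I) + D * (a * b - J)) by ring end.
      apply Rle_trans with (1 := Rabs_triang _ _).
      rewrite (Rabs_mult (Cmod d)), (Rabs_pos_eq (Cmod d)) by exact Hd0.
      apply Rmult_le_compat_l with (r := Cmod d) in H; [| exact Hd0]. lra. }
  specialize (Hind n (le_n n)). rewrite Hx1 in Hind.
  apply Rle_lt_trans with (1 := Hind).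
  apply Rlt_le_trans with ((Cmod d + 1) * e); [nra |]. right. unfold e. field. lra.
Qed.

Lemma segment_rectifiable (z d : C) : rectifiable (fun t => z + RtoC t * d)%C.
Proof.
  exists (Cmod d). intros n x [Hx0 [Hx1 Hx]].
  assert (H : forall m, (m <= n)%nat ->
    sum_n (chord (fun t => z + RtoC t * d)%C x) m = Cmod d * x (S m)).
  { assert (Hchord : forall i, (i <= n)%nat ->
      chord (fun t => z + RtoC t * d)%C x i = Cmod d * (x (S i) - x i)).
    { intros i Hi. unfold chord.
      replace (z + RtoC (x (S i)) * d - (z + RtoC (x i) * d))%C
        with (RtoC (x (S i) - x i) * d)%C by (rewrite RtoC_minus; ring).
      assert (H := Hx i Hi). rewrite Cmod_mult, Cmod_R, Rabs_pos_eq by lra. ring. }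
    induction m as [|m IH]; intros Hm.
    - rewrite sum_O, Hchord, Hx0 by exact Hm. ring_R.
    - rewrite sum_Sn, IH, Hchord by lia. unfold plus; simpl. ring_R. }
  rewrite H, Hx1 by lia. lra.
Qed.

(** The greatest lower bound of an empty set is [p_infty], whose [real] is 0, and the final estimate
    would then be lost. A straight segment, inside the disk by convexity, supplies a length. *)
Lemma unit_disk_hyperbolic_length_exists (z1 z2 : C) : unit_disk z1 -> unit_disk z2 ->
  exists (L : R) (gamma : R -> C), curve_in unit_disk z1 z2 gamma /\ rectifiable gamma /\
    is_arc_integral (fun z => 2 / (1 - Cmod z ^ 2)) gamma L.
Proof.
  intros H1 H2. set (d := (z2 - z1)%C).
  assert (Hin : forall t, 0 <= t <= 1 -> unit_disk (z1 + RtoC t * d)%C).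
  { intros t Ht. unfold unit_disk in *.
    apply Rle_lt_trans with (Rmax (Cmod z1) (Cmod z2)); [| now apply Rmax_lub_lt].
    apply Cmod_segment_le; [exact Ht | apply Rmax_l |].
    replace (z1 + d)%C with z2 by (unfold d; ring). apply Rmax_r. }
  destruct z1 as [a b]. destruct d as [p q] eqn:Ed.
  assert (Hmod : forall t, Cmod ((a, b) + RtoC t * (p, q))%C ^ 2 = (a + t * p) ^ 2 + (b + t * q) ^ 2).
  { intros t. rewrite Cmod_sqr. unfold Cplus, Cmult, RtoC; simpl. ring. }
  destruct (segment_arc_integral (fun z => 2 / (1 - Cmod z ^ 2)) (a, b) (p, q)) as [L HL].
  { intros t Ht. apply continuous_ext with (fun t => 2 / (1 - ((a + t * p) ^ 2 + (b + t * q) ^ 2))).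
    - intros s. now rewrite Hmod.
    - apply (ex_derive_continuous (fun t => 2 / (1 - ((a + t * p) ^ 2 + (b + t * q) ^ 2)))).
      specialize (Hin t Ht). unfold unit_disk in Hin. specialize (Hmod t).
      assert (H0 := Cmod_ge_0 ((a, b) + RtoC t * (p, q))%C).
      assert (Hpos : 0 < 1 - ((a + t * p) ^ 2 + (b + t * q) ^ 2)) by nra.
      auto_derive. simpl in *. lra. }
  exists L, (fun t => (a, b) + RtoC t * (p, q))%C.
  split; [| split; [apply segment_rectifiable | exact HL]].
  split; [| split; [exact Hin | split]].
  - intros t Ht. intros P HP.
    apply (filter_le_within (F := locally t)). revert P HP.
    change (continuous (fun t => (a, b) + RtoC t * (p, q))%C t).
    apply filterlim_locally. intros eps.
    assert (Ha : continuous (fun t => a + t * p) t)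
      by (apply (ex_derive_continuous (fun t => a + t * p)); auto_derive; trivial).
    assert (Hb : continuous (fun t => b + t * q) t)
      by (apply (ex_derive_continuous (fun t => b + t * q)); auto_derive; trivial).
    assert (Ha' := proj1 (filterlim_locally _ _) Ha eps).
    assert (Hb' := proj1 (filterlim_locally _ _) Hb eps).
    apply filter_imp with (2 := filter_and _ _ Ha' Hb'). intros s Hs.
    assert (E : forall u, ((a, b) + RtoC u * (p, q))%C = (a + u * p, b + u * q)).
    { intros u. unfold Cplus, Cmult, RtoC; simpl. f_equal; ring. }
    rewrite !E. exact Hs.
  - ring.
  - rewrite Cmult_1_l, <- Ed. unfold d. ring.
Qed.

Theorem corollary1p1 (alpha : R) (f fstar : C -> C) (M : R) :
  -1 < alpha ->
  alpha_harmonic alpha f ->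
  boundary_function alpha f fstar ->
  continuous_on unit_circle fstar ->
  (forall z : C, Cmod z <= 1 -> Cmod (with_boundary f fstar z) <= M) ->
  (forall z : C, unit_disk z -> unit_disk (f z)) ->
  forall z1 z2 : C, unit_disk z1 -> unit_disk z2 ->
    Cmod (f z1 - f z2)%C
      <= (alpha + 2) / c_const alpha * hyperbolic_dist z1 z2.
Proof.
  intros Hal _ Hbd Hc HM Hdisk z1 z2 Hz1 Hz2.
  assert (HM' : forall t, 0 <= t <= 2 * PI -> Cmod (fstar (cis t)) <= M).
  { intros t _. assert (H := HM (cis t)). rewrite Cmod_cis in H. specialize (H ltac:(lra)).
    unfold with_boundary in H. rewrite Cmod_cis in H. destruct (Rlt_dec 1 1); [lra | exact H]. }
  assert (HB := boundary_le_1 alpha M f fstar Hal Hbd Hc HM' Hdisk).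
  set (K := (alpha + 2) / c_const alpha).
  assert (HK : 0 < K) by (apply Rdiv_lt_0_compat; [lra | now apply c_const_pos]).
  unfold hyperbolic_dist.
  set (E := fun L : R => exists gamma : R -> C,
    curve_in unit_disk z1 z2 gamma /\ rectifiable gamma /\
    is_arc_integral (fun z => 2 / (1 - Cmod z ^ 2)) gamma L).
  destruct (Glb_Rbar_correct E) as [Hlb Hglb].
  (* Dividing by the constant makes the left side a lower bound of all lengths, hence of their
     infimum in [Rbar]. *)
  assert (Hlow : Rbar_le (Cmod (f z1 - f z2)%C / K) (Glb_Rbar E)).
  { apply Hglb. intros L [gamma [Hcurve [_ Harc]]]. simpl.
    apply Rmult_le_reg_r with K; [exact HK |].
    replace (Cmod (f z1 - f z2)%C / K * K) with (Cmod (f z1 - f z2)%C) by (field; lra).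
    rewrite Rmult_comm.
    apply (arc_integral_ge alpha L f fstar z1 z2 gamma); try assumption. apply Hbd. }
  destruct (unit_disk_hyperbolic_length_exists z1 z2 Hz1 Hz2) as [L0 HL0].
  assert (Hup := Hlb L0 HL0).
  (* The length [L0] rules out [p_infty] and [Hlow] rules out [m_infty], so [real] returns the
     infimum itself. *)
  destruct (Glb_Rbar E) as [g | |]; simpl in *; try contradiction.
  apply Rmult_le_compat_r with (r := K) in Hlow; [| lra].
  replace (Cmod (f z1 - f z2)%C / K * K) with (Cmod (f z1 - f z2)%C) in Hlow by (field; lra).
  lra.
Qed.
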